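(* Let $S$ be a countable and identifiable subset of $\mathcal L_0$ and let $\widehat{\mathbf s}$ be any $\rho$-estimator based on $S$. Then for all $\mathbf s\in\mathcal L_0$ and all $\xi>0$, $$\mathbb P_{\mathbf s}\Big[\mathbf h^2(\mathbf s,\widehat{\mathbf s})\le \inf_{\overline{\mathbf s}\in S}\big\{c_1\mathbf h^2(\mathbf s,\overline{\mathbf s})-\mathbf h^2(\mathbf s,S)+c_2D^S(\mathbf s,\overline{\mathbf s})\big\}+c_3(1.45+\xi)\Big]\ge 1-e^{-\xi}.$$ This implies in particular that $$\mathbb E_{\mathbf s}\big[\mathbf h^2(\mathbf s,\widehat{\mathbf s})\big]\le \inf_{\overline{\mathbf s}\in S}\big\{c_1\mathbf h^2(\mathbf s,\overline{\mathbf s})-\mathbf h^2(\mathbf s,S)+c_2D^S(\mathbf s,\overline{\mathbf s})\big\}+c_4$$ and, more generally, for all $\ell\ge1$, $$\mathbb E_{\mathbf s}\big[\mathbf h^\ell(\mathbf s,\widehat{\mathbf s})\big]\le C(\ell)\inf_{\overline{\mathbf s}\in S}\Big\{\mathbf h^\ell(\mathbf s,\overline{\mathbf s})+\big(D^S(\mathbf s,\overline{\mathbf s})\big)^{\ell/2}\Big\},$$ where $C(\ell)>0$ depends only on $\ell$.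
   Context: Setting. Let $n\ge3$. For $1\le i\le n$, $(\mathcal X_i,\mathcal A_i,\mu_i)$ is a measured space and $\mathcal L_i$ is the set of probability densities with respect to $\mu_i$; $\mathcal L_0=\prod_{i=1}^n\mathcal L_i$, with elements $\mathbf t=(t_1,\dots,t_n)$. $\boldsymbol X=(X_1,\dots,X_n)$ is a vector of independent random variables, $X_i$ having values in $\mathcal X_i$ and density $s_i$ with respect to $\mu_i$; $\mathbf s=(s_1,\dots,s_n)$, and $\mathbb P_{\mathbf s},\mathbb E_{\mathbf s}$ denote probability and expectation for this distribution. For densities $u,v\in\mathcal L_i$, $h^2(u,v)=\frac12\int(\sqrt u-\sqrt v)^2d\mu_i$ and $\rho(u,v)=\int\sqrt{uv}\,d\mu_i$; for $\mathbf t,\mathbf t'\in\mathcal L_0$, $\mathbf h^2(\mathbf t,\mathbf t')=\sum_{i=1}^nh^2(t_i,t_i')$, and $\mathbf h(\mathbf t,S)=\inf_{\mathbf u\in S}\mathbf h(\mathbf t,\mathbf u)$. $S\subset\mathcal L_0$ is identifiable if $\mathbf h(\mathbf u,\mathbf u')>0$ for all distinct $\mathbf u,\mathbf u'\in S$. ''Countable'' means finite or countable. Conventions: $0/0=1$, $x/0=+\infty$ for $x>0$, $0\times(+\infty)=0$, $\sup\varnothing=0$. Constants: $c_0=\frac18(1-\frac1{\sqrt2})$, $c_1=2(7+4\sqrt2)$, $c_2=1+\frac1{\sqrt2}$, $\kappa=357$, $c_3=8\kappa c_2$, $c_4=2.5c_3$. $\rho$-estimators. Let $\psi(u)=\frac{u-1}{\sqrt{1+u^2}}$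 for $u\in[0,+\infty)$ and $\psi(+\infty)=1$. For $\mathbf t,\mathbf t'\in\mathcal L_0$ and $\mathbf r=(\mathbf t+\mathbf t')/2$, $\mathbf T(\boldsymbol X,\mathbf t,\mathbf t')=\frac12\sum_{i=1}^n[\rho(t_i',r_i)-\rho(t_i,r_i)]+\frac1{\sqrt2}\sum_{i=1}^n\psi\big(\sqrt{t_i'/t_i}(X_i)\big)$. For a countable identifiable $S\subset\mathcal L_0$, $\boldsymbol\Upsilon(S,\mathbf t)=\sup_{\mathbf t'\in S}\mathbf T(\boldsymbol X,\mathbf t,\mathbf t')$ and $\mathcal E(\boldsymbol X,S)=\{\widetilde{\mathbf s}\in S:\boldsymbol\Upsilon(S,\widetilde{\mathbf s})\le\inf_{\mathbf t\in S}\boldsymbol\Upsilon(S,\mathbf t)+\kappa/10\}$. A $\rho$-estimator based on $S$ is any element $\widehat{\mathbf s}=\widehat{\mathbf s}(\boldsymbol X)$, chosen in a measurable way, of the closure $\mathrm{Cl}(\mathcal E(\boldsymbol X,S))=\{\mathbf t\in\mathcal L_0:\mathbf h(\mathbf t,\mathcal E(\boldsymbol X,S))=0\}$. Dimension. $\mathbf Z(\boldsymbol X,\mathbf t,\mathbf t')=\sum_{i=1}^n\{\psi(\sqrt{t_i'/t_i}(X_i))-\mathbb E_{\mathbf s}[\psi(\sqrt{t_i'/t_i}(X_i))]\}$. For $\overline{\mathbf s}\in\mathcal L_0$ and $y\geq 0$: $\mathcal B^S(\mathbf s,\overline{\mathbf s},y)=\{\mathbf t\in S:\mathbf h^2(\mathbf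 s,\mathbf t)+\mathbf h^2(\mathbf s,\overline{\mathbf s})\le y^2\}$, $\mathbf w^S(\mathbf s,\overline{\mathbf s},y)=\mathbb E_{\mathbf s}[\sup_{\mathbf t\in\mathcal B^S(\mathbf s,\overline{\mathbf s},y)}|\mathbf Z(\boldsymbol X,\overline{\mathbf s},\mathbf t)|]$ (equal to $0$ if the set is empty), and $D^S(\mathbf s,\overline{\mathbf s})=\overline y^2\vee1$ with $\overline y=\sup\{y\ge0:\mathbf w^S(\mathbf s,\overline{\mathbf s},y)>c_0y^2\}$. *)

(* Defs.v *)
From HB Require Import structures.
From mathcomp Require Import all_boot all_order all_algebra.
From mathcomp Require Import all_classical all_reals all_analysis.

Set Implicit Arguments.
Unset Strict Implicit.
Unset Printing Implicit Defensive.

Import Order.TTheory GRing.Theory Num.Theory.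
Import numFieldNormedType.Exports.

Local Open Scope classical_set_scope.
Local Open Scope ring_scope.

Section constants.
Context (R : realType).

Definition c0 : R := 8%:R^-1 * (1 - (Num.sqrt 2%:R)^-1).
Definition c1 : R := 2%:R * (7%:R + 4%:R * Num.sqrt 2%:R).
Definition c2 : R := 1 + (Num.sqrt 2%:R)^-1.
Definition kappa : R := 357%:R.
Definition c3 : R := 8%:R * kappa * c2.
Definition c4 : R := 5%:R / 2%:R * c3.

End constants.

Arguments c0 {R}.
Arguments c1 {R}.
Arguments c2 {R}.
Arguments c3 {R}.
Arguments c4 {R}.
Arguments kappa {R}.

(* [ereal_sup set0] is -oo; here the supremum of the empty set is 0. *)
Definition esup0 (R : realType) (A : set (\bar R)) : \bar R :=
  if A == set0 then 0%E else ereal_sup A.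

(* Quotient of nonnegative reals, with 0 / 0 = 1 and a / 0 = +oo for a > 0. *)
Definition eratio (R : realType) (a b : R) : \bar R :=
  if b == 0 then (if a == 0 then 1%:E else +oo%E) else (a / b)%:E.

(* Only arguments in [0, +oo] matter; the value at -oo is a dummy. *)
Definition psi (R : realType) (u : \bar R) : R :=
  match u with
  | EFin r => (r - 1) / Num.sqrt (1 + r ^+ 2)
  | +oo%E => 1
  | -oo%E => 0
  end.

Record density d (T : measurableType d) (R : realType)
    (mu : {measure set T -> \bar R}) := Density {
  dens :> {mfun T >-> R};
  dens_ge0 : forall x, 0 <= dens x;
  dens_int1 : (\int[mu]_x (dens x)%:E)%E = 1%E }.

Section one_coordinate.
Context d (T : measurableType d) (R : realType).
Variable mu : {measure set T -> \bar R}.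

Definition hell2 (u v : T -> R) : R :=
  2%:R^-1 * Rintegral mu setT (fun x => (Num.sqrt (u x) - Num.sqrt (v x)) ^+ 2).

Definition affinity (u v : T -> R) : R :=
  Rintegral mu setT (fun x => Num.sqrt (u x * v x)).

End one_coordinate.

Section product_setting.
Context (R : realType) (n : nat) (d : 'I_n -> measure_display).
Context (T : forall i, measurableType (d i)).
Variable mu : forall i, {measure set (T i) -> \bar R}.

Definition densities : Type := forall i, density (mu i).

Definition hellinger2 (t t' : densities) : R :=
  \sum_(i < n) hell2 (mu i) (t i) (t' i).

Definition hellinger (t t' : densities) : R := Num.sqrt (hellinger2 t t').

(* Extended-real valued, so that the distance to the empty set is +oo. *)
Definition hellinger_dist (t : densities) (S : set densities) : \bar R :=
  ereal_inf [set (hellinger t u)%:E | u in S].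

Definition identifiable (S : set densities) : Prop :=
  forall u u', S u -> S u' -> u <> u' -> 0 < hellinger u u'.

Definition hellinger_closure (S : set densities) : set densities :=
  [set t | hellinger_dist t S = 0%E].

Definition hellinger_open (U : set densities) : Prop :=
  forall t, U t ->
    exists2 e : R, 0 < e & forall u, hellinger t u < e -> U u.

Definition psi_ratio (t t' : densities) (i : 'I_n) (x : T i) : R :=
  psi (sqrte (eratio (t' i x) (t i x))).

Definition test_stat (x : forall i, T i) (t t' : densities) : R :=
  let r i := fun y : T i => (t i y + t' i y) / 2%:R in
  2%:R^-1 *
    (\sum_(i < n) (affinity (mu i) (t' i) (r i) - affinity (mu i) (t i) (r i)))
  + (Num.sqrt 2%:R)^-1 * (\sum_(i < n) psi_ratio t t' (x i)).

Definition upsilon (x : forall i, T i) (S : set densities) (t : densities)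
    : \bar R :=
  esup0 [set (test_stat x t t')%:E | t' in S].

Definition near_minimizers (x : forall i, T i) (S : set densities)
    : set densities :=
  [set t | S t /\
    (upsilon x S t <=
       ereal_inf [set upsilon x S u | u in S] + (kappa / 10%:R)%:E)%E].

(* Generators of the product sigma-algebra on [forall i, T i]. *)
Definition coordinate_cylinders : set (set (forall i, T i)) :=
  [set C | exists i, exists2 A : set (T i),
     measurable A & C = [set x | A (x i)]].

(* Measurable from the product sigma-algebra to the Borel sigma-algebra of the
   Hellinger pseudo-metric. *)
Definition estimator_measurable (f : (forall i, T i) -> densities) : Prop :=
  forall U, hellinger_open U -> <<s coordinate_cylinders >> (f @^-1` U).

Definition rho_estimator (S : set densities)
    (shat : (forall i, T i) -> densities) : Prop :=
  estimator_measurable shat /\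
  forall x, hellinger_closure (near_minimizers x S) (shat x).

Section random_vector.
Context (dO : measure_display) (Omega : measurableType dO).
Variables (P : probability Omega R) (X : forall i, {mfun Omega >-> T i}).

Definition independent_coordinates : Prop :=
  forall (J : {set 'I_n}) (A : forall i, set (T i)),
    (forall i, measurable (A i)) ->
    P [set w | forall i, i \in J -> A i (X i w)] =
    (\prod_(i in J) P (X i @^-1` A i))%E.

Definition has_densities (s : densities) : Prop :=
  forall i (A : set (T i)), measurable A ->
    P (X i @^-1` A) = (\int[mu i]_(x in A) (s i x)%:E)%E.

Definition sample (w : Omega) : forall i, T i := fun i => X i w.

Definition Zproc (t t' : densities) (w : Omega) : R :=
  \sum_(i < n) (psi_ratio t t' (sample w i) -
                fine ('E_P[fun w' => psi_ratio t t' (sample w' i)])%E).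

Definition hball (S : set densities) (s sbar : densities) (y : R)
    : set densities :=
  [set t | S t /\ hellinger2 s t + hellinger2 s sbar <= y ^+ 2].

(* Meant for [X] with independent coordinates of densities [s] under [P]; the
   result then depends on [P] and [X] only through [s]. *)
Definition wmod (S : set densities) (s sbar : densities) (y : R) : \bar R :=
  (\int[P]_w esup0 [set `|Zproc sbar t w|%:E | t in hball S s sbar y])%E.

Definition ybar (S : set densities) (s sbar : densities) : \bar R :=
  esup0 [set y%:E | y in
    [set y : R | 0 <= y /\ ((c0 * y ^+ 2)%:E < wmod S s sbar y)%E]].

Definition Ddim (S : set densities) (s sbar : densities) : \bar R :=
  maxe (ybar S s sbar ^+ 2)%E 1%E.

Definition risk_bound (S : set densities) (s : densities) : \bar R :=
  ereal_inf [set ((c1 * hellinger2 s sbar)%:E - hellinger_dist s S ^+ 2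
                  + c2%:E * Ddim S s sbar)%E | sbar in S].

End random_vector.

End product_setting.

(* Main.v *)
(* The test statistic between [sbar] and [t] has expectation at most
   [c2 * h^2(s, sbar) - (1 - 1 / sqrt 2) * h^2(s, t)], so everything reduces to
   bounding its fluctuation [Z t] by a small multiple of
   [y^2 = h^2(s, t) + h^2(s, sbar)], plus [D] and [xi], uniformly in [t]. This is done
   by peeling over the shells [y^2 ~ 2^j (D + 4000)]: outside the dimension radius,
   the expected supremum over the ball of radius [y] is at most [c0 * y^2], the
   variances are at most [6 * y^2], and a Talagrand-type inequality bounds the
   supremum.

   That inequality is proved on finite product spaces, to which one reduces by
   finite subfamilies and rounding. The symmetrized exponential moment of a supremum
   [Z] of sums is, conditionally on pairs of observations, that of a maximum of affine
   functions of random signs, to which Maurey's property (tau) applies: this gives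
   [E exp (l (Z - E Z)) <= E exp (l^2 V)] with [V] the supremum of the sums of squared
   differences. The same inequality applied to [V] itself, which is a supremum of sums
   of nonnegative terms, bounds the right-hand side by [exp (C l^2 E V)], and [E V] is
   controlled by the maximal variance and [E Z] through symmetrization and
   contraction. *)

Require Import Defs.
From HB Require Import structures.
From mathcomp Require Import all_boot all_order all_algebra.
From mathcomp Require Import all_classical all_reals all_analysis.
From mathcomp Require Import measurable_realfun.
From mathcomp Require Import ring lra.

Set Implicit Arguments.
Unset Strict Implicit.
Unset Printing Implicit Defensive.

Import Order.TTheory GRing.Theory Num.Theory.
Import numFieldNormedType.Exports.

Local Open Scope classical_set_scope.
Local Open Scope ring_scope.

(** * Rademacher averages of maxima *)

(** The constants are prescribed, so the fluctuations need an explicit bound whose variance term is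
    proportional to [y^2]; bounded differences would give a variance proxy of order [n]. Taking a
    fixed exponential parameter [1 / 300] makes the deviation grow with slope 300 in [xi], and
    [300 / sqrt 2 < 213] fits under [kappa = 357]. The shift 4000 in the radii absorbs the additive
    losses, among them those of rounding; it is paid for on the innermost shell, by
    [kappa * 27 / 20] and [D / 8]. One event per [sbar] is enough because the statistic is
    antisymmetric: an upper bound on the statistic from [sbar] to [t], uniform in [t], controls the
    supremum at [sbar], and it also excludes any [t] far from [s] whose own supremum is nearly
    minimal. The constants [c1], [c2], [c3] arise when the resulting inequality is solved for
    [h^2(s, t)]. *)

Section fmax.
Context (R : realType) (K : finType) (k0 : K).
Implicit Types F G : K -> R.

Definition fmax F : R := F [arg max_(k > k0) F k]%O.

Lemma fmax_ge F k : F k <= fmax F.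
Proof. by rewrite /fmax; case: Order.TotalTheory.arg_maxP => // i _; apply. Qed.

Lemma fmax_attained F : exists k, fmax F = F k.
Proof. by eexists. Qed.

Lemma fmax_le F c : (forall k, F k <= c) -> fmax F <= c.
Proof. exact. Qed.

Lemma le_fmax F G : (forall k, F k <= G k) -> fmax F <= fmax G.
Proof. by move=> FG; apply: fmax_le => k; apply: le_trans (fmax_ge G k). Qed.

Lemma eq_fmax F G : F =1 G -> fmax F = fmax G.
Proof. by move=> FG; apply/eqP; rewrite eq_le !le_fmax// => k; rewrite FG. Qed.

Lemma fmaxD_le F G : fmax (fun k => F k + G k) <= fmax F + fmax G.
Proof. by apply: fmax_le => k; apply: lerD; apply: fmax_ge. Qed.

Lemma fmaxM F c : 0 <= c -> fmax (fun k => c * F k) = c * fmax F.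
Proof.
move=> c0; apply/eqP; rewrite eq_le; apply/andP; split.
  by apply: fmax_le => k; rewrite ler_wpM2l// fmax_ge.
by have [k ->] := fmax_attained F; exact: (fmax_ge (fun k => c * F k)).
Qed.

End fmax.

Section rademacher.
Context (R : realType).

(** The average over the [2^n] sign patterns of length [n], written as a recursion so that
    conditioning on the first sign holds by computation. In [sg] below, [true] stands for the sign
    -1. *)
Fixpoint Erad n (F : seq bool -> R) : R :=
  if n is m.+1 then
    (Erad m (fun e => F (false :: e)) + Erad m (fun e => F (true :: e))) / 2
  else F [::].

Lemma eq_Erad n (F G : seq bool -> R) : F =1 G -> Erad n F = Erad n G.
Proof. by move=> FG; congr Erad; apply/funext. Qed.

Lemma le_Erad n (F G : seq bool -> R) :
  (forall e, F e <= G e) -> Erad n F <= Erad n G.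
Proof.
elim: n F G => [|n IH] F G FG /=; first exact: FG.
by rewrite ler_wpM2r ?invr_ge0// lerD// IH.
Qed.

Lemma Erad_cst n c : Erad n (fun=> c) = c.
Proof. by elim: n => [|n IH] //=; rewrite !IH; field. Qed.

Lemma EradD n F G : Erad n (fun e => F e + G e) = Erad n F + Erad n G.
Proof. by elim: n F G => [|n IH] F G //=; rewrite !IH; field. Qed.

Lemma EradZ n c F : Erad n (fun e => c * F e) = c * Erad n F.
Proof. by elim: n F => [|n IH] F //=; rewrite !IH; field. Qed.

Lemma Erad_sum n (I : finType) (F : I -> seq bool -> R) :
  Erad n (fun e => \sum_i F i e) = \sum_i Erad n (F i).
Proof.
elim: n F => [|n IH] F //=; rewrite !IH -big_split/= mulr_suml.
by apply: eq_bigr.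
Qed.

Lemma Erad_gt0 n F : (forall e, 0 < F e) -> 0 < Erad n F.
Proof.
elim: n F => [|n IH] F F0 /=; first exact: F0.
by rewrite divr_gt0// addr_gt0// IH.
Qed.

Lemma Erad_flip n F : Erad n (fun e => F (map negb e)) = Erad n F.
Proof.
elim: n F => [|n IH] F //=.
by rewrite (IH (fun e => F (true :: e))) (IH (fun e => F (false :: e))) addrC.
Qed.

Definition sg (e : seq bool) (i : nat) : R := (-1) ^+ nth false e i.

(** Log-convexity of exponential moments (Hoelder's inequality): after normalization by [p] and [q]
    it is the convexity of [expR] at each sign pattern. *)
Lemma Erad_expR_mix n (F G : seq bool -> R) (p q w : R) : 0 <= w <= 1 ->
  Erad n (fun e => expR (F e)) <= expR p ->
  Erad n (fun e => expR (G e)) <= expR q ->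
  Erad n (fun e => expR ((1 - w) * F e + w * G e)) <= expR ((1 - w) * p + w * q).
Proof.
move=> /andP[w0 w1] Fp Gq.
suff: Erad n (fun e => expR ((1 - w) * (F e - p) + w * (G e - q))) <= 1.
  rewrite -(ler_pM2l (expR_gt0 ((1 - w) * p + w * q))) mulr1 -EradZ.
  apply: le_trans; apply: le_Erad => e; rewrite -expRD ler_expR; lra.
have cvx e : expR ((1 - w) * (F e - p) + w * (G e - q)) <=
    (1 - w) * expR (- p) * expR (F e) + w * expR (- q) * expR (G e).
  rewrite -!mulrA -!expRD.
  have := @convex_expR R (Itv01 w0 w1) (G e - q) (F e - p).
   rewrite !convRE/= => h.
  rewrite addrC [leRHS]addrC (addrC (- p)) (addrC (- q)); exact: h.
apply: (le_trans (le_Erad n cvx)).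
rewrite EradD !EradZ.
have h1 : expR (- p) * Erad n (fun e => expR (F e)) <= 1.
  by rewrite expRN mulrC ler_pdivrMr ?expR_gt0// mul1r.
have h2 : expR (- q) * Erad n (fun e => expR (G e)) <= 1.
  by rewrite expRN mulrC ler_pdivrMr ?expR_gt0// mul1r.
rewrite -!mulrA; have w1' : 0 <= 1 - w by lra.
have := ler_wpM2l w1' h1; have := ler_wpM2l w0 h2; lra.
Qed.


(** The difference of the two sides has derivative [u * (expR u - expR (- u)) >= 0]. This settles
    the sign of the derivative in the next lemma. *)
Lemma sinh_le_mul_cosh (u : R) : 0 <= u ->
  expR u - expR (- u) <= u * (expR u + expR (- u)).
Proof.
move=> u0.
pose f (x : R) := x * (expR x + expR (- x)) - (expR x - expR (- x)).
suff: f 0 <= f u.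
  by rewrite /f !oppr0 mul0r subrr subr0 subr_ge0.
have df (x : R) : is_derive x 1 f (x * (expR x - expR (- x))).
  apply: is_derive_eq; rewrite /GRing.scale/=; ring.
apply: (@ger0_derive1_le_cc R f 0 u); rewrite ?in_itv/= ?lexx ?u0//.
- move=> x; rewrite in_itv/= => /andP[x0 _].
  rewrite derive1E (@derive_val _ _ _ _ _ _ _ (df x)) mulr_ge0 ?(ltW x0)// subr_ge0 ler_expR; lra.
- by apply: derivable_within_continuous => x _; have [] := df x.
Qed.

Lemma cosh_le_expR_sqr (u : R) : 0 <= u ->
  expR u + expR (- u) <= 2 * expR (u ^+ 2 / 2).
Proof.
move=> u0.
pose f (x : R) := - ((expR x + expR (- x)) * expR (- (x ^+ 2 / 2))).
suff: f 0 <= f u.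
  rewrite /f !oppr0 expR0 expr0n/= mul0r oppr0 expR0 mulr1 lerN2.
  by rewrite (expRN (u ^+ 2 / 2)) ler_pdivrMr ?expR_gt0//.
have df (x : R) : is_derive x 1 f
    ((x * (expR x + expR (- x)) - (expR x - expR (- x))) * expR (- (x ^+ 2 / 2))).
  by apply: is_derive_eq; rewrite /GRing.scale/=; field.
apply: (@ger0_derive1_le_cc R f 0 u); rewrite ?in_itv/= ?lexx ?u0//.
- move=> x; rewrite in_itv/= => /andP[x0 _].
  rewrite derive1E (@derive_val _ _ _ _ _ _ _ (df x)) mulr_ge0 ?expR_ge0// subr_ge0.
  by rewrite sinh_le_mul_cosh// ltW.
- by apply: derivable_within_continuous => x _; have [] := df x.
Qed.


(* The infimum over [w] plays the role of the infimum-convolution in Maurey's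
   one-dimensional property (tau). *)
Lemma two_point_bound (F1 F2 p q : R) : 0 <= F1 -> 0 <= F2 ->
  (forall w, 0 <= w <= 1 -> F1 <= expR (w ^+ 2 / 2 + ((1 - w) * p + w * q))) ->
  (forall w, 0 <= w <= 1 -> F2 <= expR (w ^+ 2 / 2 + ((1 - w) * q + w * p))) ->
  (F1 + F2) * (expR (- p) + expR (- q)) <= 4.
Proof.
wlog qp : F1 F2 p q / q <= p => [hw F10 F20 h1 h2|].
  have [|/ltW] := leP q p; first by move=> /hw; apply.
  by move=> /hw; rewrite (addrC F1) (addrC (expR _)); apply.
move=> F10 F20 h1 h2.
(* Up to exponential factors the two brackets are hyperbolic cosines of [g / 2] and [d / 2]. The
   bound on these leaves the exponent [g / 2 - d / 2 + (g^2 + d^2) / 8], at most 0 because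
   [g - d = - d^2 / 2] and [0 <= g <= d]. *)
have key (d : R) : 0 <= d -> d <= 1 ->
    (expR (d - d ^+ 2 / 2) + 1) * (expR (- d) + 1) <= 4.
  move=> d0 d1; set g := d - d ^+ 2 / 2.
  have g0 : 0 <= g by rewrite /g; nra.
  have gd : g <= d by rewrite /g; nra.
  have C (u : R) : 0 <= u -> (expR (u / 2) + expR (- (u / 2))) <=
      2 * expR (u ^+ 2 / 8).
    move=> u0; apply: (le_trans (cosh_le_expR_sqr _)); first lra.
    by rewrite ler_pM2l// ler_expR; lra.
  have -> : expR g + 1 = expR (g / 2) * (expR (g / 2) + expR (- (g / 2))).
    rewrite mulrDr expRN mulfV ?gt_eqF ?expR_gt0// -expRD; congr (expR _ + 1); lra.
  have -> : expR (- d) + 1 = expR (- (d / 2)) * (expR (d / 2) + expR (- (d / 2))).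
    rewrite mulrDr (expRN (d / 2)) mulVf ?gt_eqF ?expR_gt0// -expRN -expRD [RHS]addrC.
    congr (expR _ + 1); lra.
  have := ler_pM (addr_ge0 (expR_ge0 _) (expR_ge0 _)) (addr_ge0 (expR_ge0 _) (expR_ge0 _))
    (C g g0) (C d d0).
  have e0 := expR_ge0 (g / 2 - d / 2).
  move=> /(ler_wpM2l e0); rewrite expRD => /le_trans le4.
  rewrite mulrACA; apply: le4.
  rewrite (_ : _ * (_ * _) = 4 * (expR (g / 2 - d / 2) * expR (g ^+ 2 / 8) * expR (d ^+ 2 / 8))); last by rewrite expRD; ring.
  rewrite ger_pMr// -!expRD -[leRHS]expR0 ler_expR.
  have : g ^+ 2 <= d ^+ 2 by rewrite ler_pXn2r.
  rewrite {2}/g; lra.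
have F2q : F2 <= expR q.
  by have := h2 0; rewrite expr0n/= mul0r subr0 add0r mul0r addr0 mul1r; apply; rewrite lexx ler01.
pose d := p - q.
have Hp : expR (- p) = expR (- q) * expR (- d) by rewrite -expRD /d; congr expR; lra.
(* The exponent [p - w * d + w^2 / 2] is smallest at [w = d], admissible only if [d <= 1]. Beyond
   that [w = 1] is used, and replacing [d] by 1 in [expR (- d) + 1] only increases the left-hand
   side. *)
have [d1|d1] := leP d 1.
  have F1p : F1 <= expR q * expR (d - d ^+ 2 / 2).
    rewrite -expRD; apply: (le_trans (h1 d _)); first by rewrite /d subr_ge0 qp.
    by rewrite ler_expR le_eqVlt; apply/orP; left; apply/eqP; rewrite /d; field.
  have d0 : 0 <= d by rewrite subr_ge0.
  refine (le_trans _ (key d d0 d1)).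
  rewrite Hp -[X in _ * (_ + X)]mulr1 -mulrDr mulrCA mulrA.
  rewrite ler_wpM2r ?addr_ge0 ?expR_ge0// expRN mulrC ler_pdivrMr ?expR_gt0//.
  rewrite mulrDl mul1r; lra.
have F1p : F1 <= expR q * expR (1 - 1 ^+ 2 / 2).
  rewrite -expRD; apply: (le_trans (h1 1 _)); first by rewrite ler01 lexx.
  rewrite ler_expR; lra.
refine (le_trans _ (key 1 ler01 (lexx 1))).
rewrite Hp -[X in _ * (_ + X)]mulr1 -mulrDr mulrCA mulrA.
apply: ler_pM; rewrite ?addr_ge0 ?mulr_ge0 ?expR_ge0 ?addr_ge0//.
  rewrite expRN mulrC ler_pdivrMr ?expR_gt0// mulrDl mul1r; lra.
by rewrite lerD2r ler_expR lerN2 ltW.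
Qed.

End rademacher.
Arguments sg {R} e i.

Section tau.
Context (R : realType).

Lemma EradS n (F : seq bool -> R) : Erad n.+1 F =
  (Erad n (fun e => F (false :: e)) + Erad n (fun e => F (true :: e))) / 2.
Proof. by []. Qed.

(* Maurey's property (tau) for a maximum of affine functions on the discrete cube;
   keeping the penalty [2 * b ^+ 2] inside the maximum is what makes the
   induction on [n] close. *)
Lemma Erad_tau n (K : finType) (k0 : K) (a : K -> R) (b : K -> 'I_n -> R) :
  Erad n (fun e => expR (fmax k0 (fun k =>
     a k + \sum_(i < n) (sg e i * b k i - 2 * b k i ^+ 2)))) *
  Erad n (fun e => expR (- fmax k0 (fun k =>
     a k + \sum_(i < n) sg e i * b k i))) <= 1.
Proof.
elim: n a b => [|n IH] a b.
  rewrite /= -expRD.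
  rewrite (_ : _ + _ = 0) ?expR0//; apply/eqP; rewrite subr_eq0; apply/eqP.
  by apply: eq_fmax => k; rewrite !big_ord0.
pose b' k i := b k (lift ord0 i).
pose Q s e := fmax k0 (fun k => a k + s * b k ord0 +
  \sum_(i < n) (sg e i * b' k i - 2 * b' k i ^+ 2)).
pose G s e := fmax k0 (fun k => a k + s * b k ord0 + \sum_(i < n) sg e i * b' k i).
have IHs s := IH (fun k => a k + s * b k ord0) b'.
pose p := - ln (Erad n (fun e => expR (- G 1 e))).
pose q := - ln (Erad n (fun e => expR (- G (-1) e))).
have GE s : expR (ln (Erad n (fun e => expR (- G s e)))) = Erad n (fun e => expR (- G s e)).
  by rewrite lnK// posrE Erad_gt0// => e; exact: expR_gt0.
have Ep : Erad n (fun e => expR (- G 1 e)) = expR (- p) by rewrite opprK GE.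
have Eq : Erad n (fun e => expR (- G (-1) e)) = expR (- q) by rewrite opprK GE.
have Qp : Erad n (fun e => expR (Q 1 e)) <= expR p.
  rewrite -[p]opprK expRN -Ep -[leRHS]div1r ler_pdivlMr ?Ep ?expR_gt0// -Ep.
  exact: IHs.
have Qq : Erad n (fun e => expR (Q (-1) e)) <= expR q.
  rewrite -[q]opprK expRN -Eq -[leRHS]div1r ler_pdivlMr ?Eq ?expR_gt0// -Eq.
  exact: IHs.
pose H s e := fmax k0 (fun k => a k + s * b k ord0 - 2 * b k ord0 ^+ 2 +
  \sum_(i < n) (sg e i * b' k i - 2 * b' k i ^+ 2)).
(* Giving weight [w] to the opposite first sign changes the affine part of index [k] by
   [- 2 * w * s * b k ord0]. The penalty [2 * b k ord0 ^+ 2] together with [w ^+ 2 / 2] covers this,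
   since [(w - 2 * s * b k ord0) ^+ 2 >= 0]. *)
have HQ s w e : (s = 1 \/ s = -1) -> 0 <= w <= 1 ->
    H s e <= w ^+ 2 / 2 + ((1 - w) * Q s e + w * Q (- s) e).
  move=> hs /andP[w0 w1].
  have w1' : 0 <= 1 - w by rewrite subr_ge0.
  rewrite -!fmaxM//.
  have [k Hk] := fmax_attained k0 (fun k => a k + s * b k ord0 - 2 * b k ord0 ^+ 2 +
    \sum_(i < n) (sg e i * b' k i - 2 * b' k i ^+ 2)).
  rewrite /H Hk.
  set S := \sum_(i < n) _.
  have := fmax_ge k0 (fun k => (1 - w) * (a k + s * b k ord0 +
    \sum_(i < n) (sg e i * b' k i - 2 * b' k i ^+ 2))) k.
  have := fmax_ge k0 (fun k => w * (a k + (- s) * b k ord0 +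
    \sum_(i < n) (sg e i * b' k i - 2 * b' k i ^+ 2))) k.
  rewrite -/S => h1 h2.
  have : 0 <= (w - 2 * (s * b k ord0)) ^+ 2 by exact: sqr_ge0.
  have : (s * b k ord0) ^+ 2 = b k ord0 ^+ 2 by case: hs => ->; ring.
  move: h1 h2; set f1 := fmax _ _; set f2 := fmax _ _.
  move: f1 f2 S (a k) (b k ord0) => f1 f2 S x y; clear; lra.
have E1 : Erad n.+1 (fun e => expR (fmax k0 (fun k =>
     a k + \sum_(i < n.+1) (sg e i * b k i - 2 * b k i ^+ 2)))) =
    (Erad n (fun e => expR (H 1 e)) + Erad n (fun e => expR (H (-1) e))) / 2.
  rewrite EradS; congr ((_ + _) / 2); apply: eq_Erad => e; congr expR;
  by apply: eq_fmax => k; rewrite big_ord_recl !addrA.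
have E2 : Erad n.+1 (fun e => expR (- fmax k0 (fun k =>
     a k + \sum_(i < n.+1) sg e i * b k i))) =
    (Erad n (fun e => expR (- G 1 e)) + Erad n (fun e => expR (- G (-1) e))) / 2.
  rewrite EradS; congr ((_ + _) / 2); apply: eq_Erad => e;
  congr expR; apply/eqP; rewrite eqr_opp; apply/eqP;
  by apply: eq_fmax => k; rewrite big_ord_recl !addrA.
rewrite E1 E2 Ep Eq mulrACA -invfM -natrM ler_pdivrMr// mul1r.
have pos (F : seq bool -> R) : 0 <= Erad n (fun e => expR (F e)).
  by apply/ltW/Erad_gt0 => e; exact: expR_gt0.
apply: two_point_bound => [||w w01|w w01]; [exact: pos|exact: pos| |].
  rewrite expRD; refine (le_trans _ (ler_wpM2l (expR_ge0 _) (Erad_expR_mix w01 Qp Qq))).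
  by rewrite -EradZ; apply: le_Erad => e; rewrite -expRD ler_expR; apply: HQ => //; left.
rewrite expRD; refine (le_trans _ (ler_wpM2l (expR_ge0 _) (Erad_expR_mix w01 Qq Qp))).
rewrite -EradZ; apply: le_Erad => e; rewrite -expRD ler_expR.
by have := @HQ (-1) w e; rewrite opprK; apply; [right|].
Qed.

End tau.

Section rademacher_concentration.
Context (R : realType).

Lemma le_Erad_size n (F G : seq bool -> R) :
  (forall e, size e = n -> F e <= G e) -> Erad n F <= Erad n G.
Proof.
elim: n F G => [|n IH] F G FG; first exact: FG.
by rewrite !EradS ler_wpM2r ?invr_ge0// lerD// IH// => e se; rewrite FG//= se.
Qed.

Lemma eq_Erad_size n (F G : seq bool -> R) :
  (forall e, size e = n -> F e = G e) -> Erad n F = Erad n G.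
Proof.
by move=> FG; apply/eqP; rewrite eq_le !le_Erad_size// => e /FG ->.
Qed.

Lemma sg_flip n (e : seq bool) (i : 'I_n) : size e = n ->
  sg (map negb e) i = - sg e i :> R.
Proof.
move=> se; rewrite /sg (nth_map false) ?se//.
by case: nth; rewrite ?expr0 ?expr1// opprK.
Qed.

(** The second maximum is the first one with all signs flipped: it has the same law but is not
    independent of it. The inequality between arithmetic and geometric means splits the exponential
    into [expR (2 * l * G)] and [expR (- (2 * l * G'))], and property (tau) bounds the product of
    their means. *)
Lemma Erad_expR_sym n (K : finType) (k0 : K) (a : K -> R) (b : K -> 'I_n -> R)
    (l L : R) : 0 <= l -> (forall k, \sum_(i < n) b k i ^+ 2 <= L) ->
  Erad n (fun e => expR (l *
    (fmax k0 (fun k => a k + \sum_(i < n) sg e i * b k i) -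
     fmax k0 (fun k => a k + \sum_(i < n) - sg e i * b k i)))) <=
  expR (4 * l ^+ 2 * L).
Proof.
move=> l0 bL.
pose G e := fmax k0 (fun k => a k + \sum_(i < n) sg e i * b k i).
pose G' e := fmax k0 (fun k => a k + \sum_(i < n) - sg e i * b k i).
have GG' e : size e = n -> G' e = G (map negb e).
  move=> se; apply: eq_fmax => k; congr (_ + _).
  by apply: eq_bigr => i _; rewrite sg_flip.
set A := Erad n (fun e => expR (2 * l * G e)).
set B := Erad n (fun e => expR (- (2 * l * G e))).
have B' : Erad n (fun e => expR (- (2 * l * G' e))) = B.
  rewrite /B -[RHS]Erad_flip; apply: eq_Erad_size => e se.
  by rewrite GG'.
have A0 : 0 < A by apply: Erad_gt0 => e; exact: expR_gt0.
have B0 : 0 < B by apply: Erad_gt0 => e; exact: expR_gt0.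
set M := expR (4 * l ^+ 2 * L).
have M0 : 0 < M := expR_gt0 _.
have ABM : A * B <= M * M.
  have := Erad_tau k0 (fun k => 2 * l * a k) (fun k i => 2 * l * b k i).
  have l20 : 0 <= 2 * l by rewrite mulr_ge0.
  have EG e : fmax k0 (fun k => 2 * l * a k +
      \sum_(i < n) sg e i * (2 * l * b k i)) = 2 * l * G e.
    rewrite /G -(fmaxM k0 _ l20); apply: eq_fmax => k.
    rewrite mulrDr mulr_sumr; congr (_ + _); apply: eq_bigr => i _; ring.
  rewrite [X in _ * X](@eq_Erad R n _ (fun e => expR (- (2 * l * G e)))); last first.
    by move=> e; rewrite EG.
  rewrite -/B => tau.
  have MA : A * (M * M)^-1 <= Erad n (fun e => expR (fmax k0 (fun k => 2 * l * a k +
     \sum_(i < n) (sg e i * (2 * l * b k i) - 2 * (2 * l * b k i) ^+ 2)))).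
    rewrite mulrC -EradZ; apply: le_Erad => e.
    rewrite -expRD -expRN -expRD ler_expR -EG.
    have [k ->] := fmax_attained k0 (fun k => 2 * l * a k +
      \sum_(i < n) sg e i * (2 * l * b k i)).
    apply: le_trans (fmax_ge _ _ k).
    rewrite [leLHS]addrC big_split/= [leRHS]addrA lerD2l.
    have -> : \sum_(i < n) - (2 * (2 * l * b k i) ^+ 2) =
        - (8 * l ^+ 2 * \sum_(i < n) b k i ^+ 2).
      by rewrite mulr_sumr -sumrN; apply: eq_bigr => i _; ring.
    rewrite lerN2; have := ler_wpM2l (mulr_ge0 (ler0n R 8) (sqr_ge0 l)) (bL k).
    lra.
  have := le_trans (ler_wpM2r (ltW B0) MA) tau.
  by rewrite mulrAC ler_pdivrMr ?mulr_gt0// mul1r.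
(* With this weight the mean of each of the two terms is at most [M / 2]. *)
pose s := M / A.
have s0 : 0 < s by rewrite divr_gt0.
have amgm e : expR (l * (G e - G' e)) <=
    s / 2 * expR (2 * l * G e) + (s^-1 / 2) * expR (- (2 * l * G' e)).
  have -> : expR (l * (G e - G' e)) = expR (l * G e) * expR (- (l * G' e)).
    by rewrite -expRD; congr expR; ring.
  have -> : expR (2 * l * G e) = expR (l * G e) ^+ 2.
    by rewrite expr2 -expRD; congr expR; ring.
  have -> : expR (- (2 * l * G' e)) = expR (- (l * G' e)) ^+ 2.
    by rewrite expr2 -expRD; congr expR; ring.
  move: (expR (l * G e)) (expR (- (l * G' e))) => x y.
  rewrite -subr_ge0.
  have -> : s / 2 * x ^+ 2 + s^-1 / 2 * y ^+ 2 - x * y =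
      (s * x - y) ^+ 2 / (2 * s) by field; rewrite gt_eqF.
  by rewrite divr_ge0 ?sqr_ge0// mulr_ge0// ltW.
apply: (le_trans (le_Erad n amgm)).
rewrite EradD !EradZ -/A B' /s.
have -> : M / A / 2 * A = M / 2 by field; rewrite gt_eqF.
have : (M / A)^-1 / 2 * B <= M / 2.
  rewrite invf_div mulrAC ler_wpM2r ?invr_ge0//.
  by rewrite mulrAC ler_pdivrMr.
lra.
Qed.

(** The contraction principle, by replacing one coordinate at a time. With the other signs fixed,
    the maxima for the two values of one sign, attained at [k] and [k'], see this coordinate only
    through [u k - u k']; according to the sign of [v k - v k'], the indices [k] and [k'] keep or
    exchange their roles. *)
Lemma Erad_contraction n (K : finType) (k0 : K) (a : K -> R)
    (u v : K -> 'I_n -> R) :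
  (forall i k k', `|u k i - u k' i| <= `|v k i - v k' i|) ->
  Erad n (fun e => fmax k0 (fun k => a k + \sum_(i < n) sg e i * u k i)) <=
  Erad n (fun e => fmax k0 (fun k => a k + \sum_(i < n) sg e i * v k i)).
Proof.
elim: n a u v => [|n IH] a u v uv.
  by apply: le_fmax => k; rewrite !big_ord0.
have ES (w : K -> 'I_n.+1 -> R) : Erad n.+1 (fun e => fmax k0 (fun k => a k +
    \sum_(i < n.+1) sg e i * w k i)) =
    Erad n (fun e => (fmax k0 (fun k => (a k + w k ord0) +
      \sum_(i < n) sg e i * w k (lift ord0 i)) +
     fmax k0 (fun k => (a k - w k ord0) +
      \sum_(i < n) sg e i * w k (lift ord0 i))) / 2).
  rewrite EradS -EradD mulrC -EradZ; apply: eq_Erad => e; rewrite mulrC.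
  congr ((_ + _) / 2); apply: eq_fmax => k; rewrite big_ord_recl addrA.
    by rewrite /sg/= expr0 mul1r.
  by rewrite /sg/= expr1 mulN1r.
rewrite !ES.
apply: (@le_trans _ _ (Erad n (fun e => (fmax k0 (fun k => (a k + v k ord0) +
      \sum_(i < n) sg e i * u k (lift ord0 i)) +
     fmax k0 (fun k => (a k - v k ord0) +
      \sum_(i < n) sg e i * u k (lift ord0 i))) / 2))).
  apply: le_Erad => e; rewrite ler_wpM2r ?invr_ge0//.
  pose S k := \sum_(i < n) sg e i * u k (lift ord0 i).
  have [k ->] := fmax_attained k0 (fun k => (a k + u k ord0) + S k).
  have [k' ->] := fmax_attained k0 (fun k => (a k - u k ord0) + S k).
  have := uv ord0 k k'.
  have := ler_norm (u k ord0 - u k' ord0).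
  have := fmax_ge k0 (fun k => (a k + v k ord0) + S k) k.
  have := fmax_ge k0 (fun k => (a k + v k ord0) + S k) k'.
  have := fmax_ge k0 (fun k => (a k - v k ord0) + S k) k.
  have := fmax_ge k0 (fun k => (a k - v k ord0) + S k) k'.
  rewrite /S /=; set f1 := fmax _ _; set f2 := fmax _ _.
  move: f1 f2 (a k) (a k') (u k ord0) (u k' ord0) (v k ord0) (v k' ord0)
    (\sum_(i < n) sg e i * u k (lift ord0 i))
    (\sum_(i < n) sg e i * u k' (lift ord0 i)).
  move=> f1 f2 ak ak' uk uk' vk vk' Sk Sk'; clear.
  by case: (ger0P (vk - vk')) => h; lra.
have half (F G : seq bool -> R) : Erad n (fun e => (F e + G e) / 2) =
    (Erad n F + Erad n G) / 2.
  by rewrite -EradD mulrC -EradZ; apply: eq_Erad => e; rewrite mulrC.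
rewrite !half ler_wpM2r ?invr_ge0// lerD//; apply: IH => i k k'; exact: uv.
Qed.

End rademacher_concentration.

(** * Concentration on finite product spaces *)

Section finite_expectation.
Context (R : realType).

Definition is_pmf (I : finType) (q : I -> R) :=
  (forall x, 0 <= q x) /\ \sum_x q x = 1.

Definition Ex (I : finType) (q : I -> R) (F : I -> R) : R := \sum_x q x * F x.

Section one_space.
Context (I : finType) (q : I -> R) (qP : is_pmf q).
Implicit Types F G : I -> R.

Lemma eq_Ex F G : F =1 G -> Ex q F = Ex q G.
Proof. by move=> FG; apply: eq_bigr => x _; rewrite FG. Qed.

Lemma le_Ex F G : (forall x, F x <= G x) -> Ex q F <= Ex q G.
Proof. by move=> FG; apply: ler_sum => x _; rewrite ler_wpM2l// qP.1. Qed.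

Lemma Ex_cst c : Ex q (fun=> c) = c.
Proof. by rewrite /Ex -mulr_suml qP.2 mul1r. Qed.

Lemma ExD F G : Ex q (fun x => F x + G x) = Ex q F + Ex q G.
Proof. by rewrite /Ex -big_split/=; apply: eq_bigr => x _; rewrite mulrDr. Qed.

Lemma ExZ c F : Ex q (fun x => c * F x) = c * Ex q F.
Proof. by rewrite /Ex mulr_sumr; apply: eq_bigr => x _; rewrite mulrCA. Qed.

Lemma ExN F : Ex q (fun x => - F x) = - Ex q F.
Proof. by rewrite /Ex -sumrN; apply: eq_bigr => x _; rewrite mulrN. Qed.

Lemma Ex_sum (J : finType) (F : J -> I -> R) :
  Ex q (fun x => \sum_j F j x) = \sum_j Ex q (F j).
Proof.
by rewrite /Ex exchange_big/=; apply: eq_bigr => x _; rewrite mulr_sumr.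
Qed.

Lemma Ex_Erad n (F : I -> seq bool -> R) :
  Ex q (fun x => Erad n (F x)) = Erad n (fun e => Ex q (fun x => F x e)).
Proof. by rewrite /Ex Erad_sum; apply: eq_bigr => x _; rewrite EradZ. Qed.

(** Jensen's inequality, from the tangent to the exponential at the mean. *)
Lemma expR_Ex_le F : expR (Ex q F) <= Ex q (fun x => expR (F x)).
Proof.
set m := Ex q F.
have : Ex q (fun x => expR m * (1 + (F x - m))) <= Ex q (fun x => expR (F x)).
  apply: le_Ex => x; rewrite (_ : F x = m + (F x - m)); last by lra.
  by rewrite expRD ler_wpM2l ?expR_ge0// (_ : m + _ - m = F x - m); [exact: expR_ge1Dx|lra].
by rewrite ExZ !ExD !Ex_cst -/m subrr addr0 mulr1.
Qed.

Lemma Ex_expR_gt0 F : 0 < Ex q (fun x => expR (F x)).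
Proof. exact: lt_le_trans (expR_gt0 _) (expR_Ex_le F). Qed.

Lemma Ex_expR_power F (w L : R) : 0 <= w <= 1 ->
  Ex q (fun x => expR (F x)) <= expR L -> Ex q (fun x => expR (w * F x)) <= expR (w * L).
Proof.
move=> /andP[w0 w1] FL.
rewrite -[leRHS]mulr1 mulrC -ler_pdivrMr ?expR_gt0// mulrC -expRN -ExZ.
have cvx x : expR (- (w * L)) * expR (w * F x) <= w * (expR (- L) * expR (F x)) + (1 - w).
  rewrite -!expRD.
  have := @convex_expR R (Itv01 w0 w1) (F x - L) 0.
  rewrite !convRE/= expR0 mulr0 addr0 mulr1 (addrC (- L)).
  by rewrite (_ : w * (F x - L) = - (w * L) + w * F x)//; ring.
apply: (le_trans (le_Ex cvx)).
rewrite ExD !ExZ Ex_cst.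
have h1 : expR (- L) * Ex q (fun x => expR (F x)) <= 1.
  by rewrite expRN mulrC ler_pdivrMr ?expR_gt0// mul1r.
have := ler_wpM2l w0 h1; lra.
Qed.

End one_space.

Section product_space.
Context (n : nat) (A : finType).
Implicit Types (p : 'I_n -> A -> R) (x : {ffun 'I_n -> A}).

Definition pprod p x : R := \prod_i p i (x i).

Lemma is_pmf_pprod p : (forall i, is_pmf (p i)) -> is_pmf (pprod p).
Proof.
move=> pP; split=> [x|]; first by rewrite prodr_ge0// => i _; exact: (pP i).1.
rewrite /pprod -(bigA_distr_bigA p)/= big1// => i _; exact: (pP i).2.
Qed.

Lemma Ex_pprod_coord p i (F : A -> R) : (forall i, is_pmf (p i)) ->
  Ex (pprod p) (fun x => F (x i)) = Ex (p i) F.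
Proof.
move=> pP; rewrite /Ex /pprod.
transitivity (\sum_(x : {ffun 'I_n -> A})
    \prod_j (p j (x j) * (if j == i then F (x j) else 1))).
  apply: eq_bigr => x _; rewrite big_split/=; congr (_ * _).
  by rewrite -(big_mkcond (fun j => j == i))/= big_pred1_eq.
rewrite -(bigA_distr_bigA (fun j a => p j a * (if j == i then F a else 1))).
rewrite (bigD1 i)//= [X in _ * X]big1 ?mulr1.
  by apply: eq_bigr => a _; rewrite eqxx.
move=> j ji; rewrite -[RHS](pP j).2; apply: eq_bigr => a _.
by rewrite (negPf ji) mulr1.
Qed.

Definition Ex2 p (F : {ffun 'I_n -> A} -> {ffun 'I_n -> A} -> R) :=
  Ex (pprod p) (fun x => Ex (pprod p) (F x)).

Definition swap (e : seq bool) x x' : {ffun 'I_n -> A} :=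
  [ffun i : 'I_n => if nth false e i then x' i else x i].

(** The weight of a pair of samples does not change when coordinates are exchanged between them;
    averaging over [e] is then what brings in random signs. *)
Lemma Ex2_swap p F e : Ex2 p F = Ex2 p (fun x x' => F (swap e x x') (swap e x' x)).
Proof.
have E G : Ex2 p G = \sum_(z : {ffun 'I_n -> A} * {ffun 'I_n -> A})
    pprod p z.1 * pprod p z.2 * G z.1 z.2.
  rewrite /Ex2 /Ex.
  under eq_bigr do rewrite mulr_sumr.
  rewrite pair_big/=; apply: eq_bigr => z _; by rewrite mulrA.
rewrite !E.
pose h (z : {ffun 'I_n -> A} * {ffun 'I_n -> A}) := (swap e z.1 z.2, swap e z.2 z.1).
have hK : involutive h.
  move=> [x x']; rewrite /h/=; congr (_, _); apply/ffunP => i; rewrite !ffunE;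
  by case: nth.
rewrite (reindex_inj (inv_inj hK))/=; apply: eq_bigr => z _; congr (_ * _).
rewrite /pprod -!big_split/=; apply: eq_bigr => i _; rewrite !ffunE.
by case: ifP => _ //; rewrite mulrC.
Qed.

Lemma Ex2_Erad p F :
  Ex2 p F = Ex2 p (fun x x' => Erad n (fun e => F (swap e x x') (swap e x' x))).
Proof.
transitivity (Erad n (fun e => Ex2 p (fun x x' => F (swap e x x') (swap e x' x)))).
  by rewrite -[LHS](Erad_cst n); apply: eq_Erad => e; exact: Ex2_swap.
rewrite /Ex2 -Ex_Erad; apply: eq_Ex => x; by rewrite -Ex_Erad.
Qed.

Lemma le_Ex2 p F G : (forall i, is_pmf (p i)) ->
  (forall x x', F x x' <= G x x') -> Ex2 p F <= Ex2 p G.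
Proof.
by move=> /is_pmf_pprod pP FG; do 2!apply: le_Ex => // ?.
Qed.

End product_space.

Section pair_space.
Context (n : nat) (A : finType).
Implicit Types (p : 'I_n -> A -> R).

Definition ppair p (i : 'I_n) (a : A * A) : R := p i a.1 * p i a.2.

Lemma is_pmf_ppair p : (forall i, is_pmf (p i)) -> forall i, is_pmf (ppair p i).
Proof.
move=> pP i; split=> [a|]; first by rewrite mulr_ge0//; apply: (pP i).1.
rewrite -(pair_big xpredT xpredT (fun a a' => p i a * p i a'))/=.
under eq_bigr do rewrite -mulr_sumr (pP i).2 mulr1.
exact: (pP i).2.
Qed.

(** Two independent samples form one sample of independent pairs, so results on a single product
    space apply to functions of both samples. *)
Lemma Ex2E p F : Ex2 p F = Ex (pprod (ppair p))
  (fun z => F [ffun i => (z i).1] [ffun i => (z i).2]).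
Proof.
rewrite /Ex2 /Ex; under eq_bigr do rewrite mulr_sumr.
rewrite pair_big/=.
pose h (z : {ffun 'I_n -> A * A}) : {ffun 'I_n -> A} * {ffun 'I_n -> A} :=
  ([ffun i => (z i).1], [ffun i => (z i).2]).
pose g (y : {ffun 'I_n -> A} * {ffun 'I_n -> A}) : {ffun 'I_n -> A * A} :=
  [ffun i => (y.1 i, y.2 i)].
rewrite (reindex h)/=; last first.
  exists g => [z _|[x x'] _].
    by apply/ffunP => i; rewrite !ffunE -surjective_pairing.
  by congr (_, _); apply/ffunP => i; rewrite !ffunE.
apply: eq_bigr => z _; rewrite mulrA; congr (_ * _).
by rewrite /pprod -big_split/=; apply: eq_bigr => i _; rewrite !ffunE.
Qed.

End pair_space.
End finite_expectation.

Section concentration.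
Context (R : realType) (n : nat) (K : finType) (k0 : K).

Definition maxsum (A : finType) (f : 'I_n -> K -> A -> R) (x : {ffun 'I_n -> A}) : R :=
  fmax k0 (fun k => \sum_i f i k (x i)).

Definition maxsqr (A : finType) (f : 'I_n -> K -> A -> R) (x x' : {ffun 'I_n -> A}) : R :=
  fmax k0 (fun k => \sum_i (f i k (x i) - f i k (x' i)) ^+ 2).

Lemma maxsum_swap (A : finType) (f : 'I_n -> K -> A -> R) e x x' :
  maxsum f (swap e x x') = fmax k0 (fun k =>
    \sum_i (f i k (x i) + f i k (x' i)) / 2 +
    \sum_(i < n) sg e i * ((f i k (x i) - f i k (x' i)) / 2)).
Proof.
apply: eq_fmax => k; rewrite -big_split/=; apply: eq_bigr => i _.
by rewrite ffunE /sg; case: nth; rewrite ?expr0 ?expr1; field.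
Qed.

(* Given the unordered pairs [{x i, x' i}], both maxima are maxima of affine
   functions of the signs that say which of the two is [x i]. *)
Lemma mgf_symmetrization (A : finType) (p : 'I_n -> A -> R) (f : 'I_n -> K -> A -> R) (l : R) :
  (forall i, is_pmf (p i)) -> 0 <= l ->
  Ex (pprod p) (fun x => expR (l * (maxsum f x - Ex (pprod p) (maxsum f)))) <=
  Ex2 p (fun x x' => expR (l ^+ 2 * maxsqr f x x')).
Proof.
move=> pP l0; have ppP := is_pmf_pprod pP.
apply: (@le_trans _ _ (Ex2 p (fun x x' => expR (l * (maxsum f x - maxsum f x'))))).
  apply: le_Ex => // x; refine (le_trans _ (expR_Ex_le ppP _)).
  by rewrite ler_expR ExZ ExD Ex_cst// ExN.
rewrite Ex2_Erad; apply: le_Ex2 => // x x'.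
(* An exchange of [x i] and [x' i] moves the summand around the average of its two values by half of
   their difference, hence the quarter. *)
have -> : l ^+ 2 * maxsqr f x x' = 4 * l ^+ 2 * (maxsqr f x x' / 4) by field.
have bL k : \sum_(i < n) ((f i k (x i) - f i k (x' i)) / 2) ^+ 2 <= maxsqr f x x' / 4.
  have -> : \sum_(i < n) ((f i k (x i) - f i k (x' i)) / 2) ^+ 2 =
      (\sum_(i < n) (f i k (x i) - f i k (x' i)) ^+ 2) / 4.
    by rewrite mulr_suml; apply: eq_bigr => i _; field.
  by rewrite ler_wpM2r ?invr_ge0//; exact: (fmax_ge k0 (fun k => \sum_i (f i k (x i) - f i k (x' i)) ^+ 2)).
refine (le_trans _ (Erad_expR_sym k0 (fun k => \sum_i (f i k (x i) + f i k (x' i)) / 2) l0 bL)).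
apply: le_Erad => e; rewrite ler_expR ler_wpM2l// !maxsum_swap lerD2l lerN2.
apply: le_fmax => k; rewrite -!big_split/=; apply: ler_sum => i _; lra.
Qed.

(* Since [(g - g')^2 <= g + g'], symmetrization bounds the exponential moment at
   [t] by the one at [t ^+ 2], hence by a power of itself. *)
Lemma mgf_nonneg (A : finType) (p : 'I_n -> A -> R) (g : 'I_n -> K -> A -> R) (t : R) :
  (forall i, is_pmf (p i)) -> (forall i k a, 0 <= g i k a <= 1) ->
  0 <= t -> 2 * t < 1 ->
  Ex (pprod p) (fun x => expR (t * maxsum g x)) <=
  expR (t * Ex (pprod p) (maxsum g) / (1 - 2 * t)).
Proof.
move=> pP g01 t0 t1; have ppP := is_pmf_pprod pP.
set E := Ex (pprod p) (fun x => expR (t * maxsum g x)).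
have E0 : 0 < E by exact: Ex_expR_gt0.
pose L := ln E; have EL : E = expR L by rewrite lnK.
set m := Ex (pprod p) (maxsum g).
have Et : Ex (pprod p) (fun x => expR (t ^+ 2 * maxsum g x)) <= expR (t * L).
  have := @Ex_expR_power R _ _ ppP (fun x => t * maxsum g x) t L.
  have -> : (fun x => expR (t * (t * maxsum g x))) = (fun x => expR (t ^+ 2 * maxsum g x)).
    by apply/funext => x; rewrite mulrA -expr2.
  by apply; [lra|rewrite -EL].
have := mgf_symmetrization g pP t0; rewrite -/m.
have -> : Ex (pprod p) (fun x => expR (t * (maxsum g x - m))) = expR (L - t * m).
  rewrite expRD -EL mulrC -ExZ; apply: eq_Ex => x.
  by rewrite -expRD; congr expR; ring.
move=> h.
have {}h : expR (L - t * m) <= expR (2 * t * L).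
  apply: (le_trans h).
  apply: (@le_trans _ _ (Ex2 p (fun x x' => expR (t ^+ 2 * maxsum g x) * expR (t ^+ 2 * maxsum g x')))).
    apply: le_Ex2 => // x x'; rewrite -expRD ler_expR -mulrDr ler_wpM2l ?sqr_ge0//.
    rewrite /maxsqr; have [k ->] := fmax_attained k0 (fun k => \sum_i (g i k (x i) - g i k (x' i)) ^+ 2).
    have h1 := fmax_ge k0 (fun k => \sum_i g i k (x i)) k.
    have h2 := fmax_ge k0 (fun k => \sum_i g i k (x' i)) k.
    refine (le_trans _ (lerD h1 h2)); rewrite -big_split/=; apply: ler_sum => i _.
    have := g01 i k (x i); have := g01 i k (x' i); nra.
  have -> : 2 * t * L = t * L + t * L by ring.
  rewrite expRD /Ex2; under eq_Ex do rewrite ExZ mulrC.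
  rewrite ExZ; apply: ler_pM => //; exact/ltW/Ex_expR_gt0.
move: h; rewrite ler_expR => h.
by rewrite EL ler_expR ler_pdivlMr; lra.
Qed.

(** Since the sums have mean at most [v], subtracting an independent copy costs at most [v] by
    Jensen's inequality. The difference is symmetrized, and each of the two samples contributes one
    Rademacher average. *)
Lemma Ex_maxsum_le (A : finType) (p : 'I_n -> A -> R) (h : 'I_n -> K -> A -> R) (v : R) :
  (forall i, is_pmf (p i)) -> (forall k, \sum_i Ex (p i) (h i k) <= v) ->
  Ex (pprod p) (maxsum h) <= v + 2 * Ex (pprod p) (fun x => Erad n (fun e =>
    fmax k0 (fun k => \sum_(i < n) sg e i * h i k (x i)))).
Proof.
move=> pP hv; have ppP := is_pmf_pprod pP.
pose S k (x : {ffun 'I_n -> A}) := \sum_i h i k (x i).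
have ES k : Ex (pprod p) (S k) <= v.
  by rewrite Ex_sum; under eq_bigr do rewrite (Ex_pprod_coord _ (h _ k))//.
apply: (@le_trans _ _ (v + Ex2 p (fun x x' => fmax k0 (fun k => S k x - S k x')))).
  rewrite -[v in leRHS](Ex_cst ppP) -ExD; apply: le_Ex => // x.
  rewrite /maxsum; have [k ->] := fmax_attained k0 (fun k => \sum_i h i k (x i)).
  have : Ex (pprod p) (fun x' => S k x - S k x') <=
      Ex (pprod p) (fun x' => fmax k0 (fun k => S k x - S k x')).
    by apply: le_Ex => // x'; exact: (fmax_ge k0 (fun k => S k x - S k x')).
  rewrite ExD ExN Ex_cst// -/(S k x); have := ES k.
  move: (Ex _ _) (Ex _ _) (S k x) => a b c; clear; lra.
rewrite lerD2l Ex2_Erad.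
apply: (@le_trans _ _ (Ex2 p (fun x x' =>
  Erad n (fun e => fmax k0 (fun k => \sum_(i < n) sg e i * h i k (x i))) +
  Erad n (fun e => fmax k0 (fun k => \sum_(i < n) sg e i * h i k (x' i)))))).
  apply: le_Ex2 => // x x'.
  rewrite -[X in _ <= _ + X]Erad_flip -EradD; apply: le_Erad_size => e se.
  refine (le_trans _ (fmaxD_le _ _ _)); apply: le_fmax => k.
  rewrite /S -sumrB -big_split/=; apply: ler_sum => i _.
  rewrite sg_flip// !ffunE /sg; case: nth; rewrite ?expr0 ?expr1; lra.
rewrite /Ex2; under eq_Ex do rewrite ExD Ex_cst//.
rewrite ExD Ex_cst//; lra.
Qed.

Context (neg : K -> K).

(** The squared differences are 4 times functions of the pairs with values in [0, 1], so the bound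
    for such sums applies at [4 * l ^+ 2], whence [1 - 8 * l ^+ 2]. Their maximal sum has mean at
    most [2 * v], from twice the variances, plus a multiple of the mean of [maxsum f]:
    symmetrization gives a factor 2, contraction 4 as squaring is 4-Lipschitz on [-2, 2], and
    removal of the signs 2, so 16 in all. The map [neg] bounds the sums of [- f] by the same
    maximum. *)
Lemma mgf_maxsum (A : finType) (p : 'I_n -> A -> R) (f : 'I_n -> K -> A -> R) (l v : R) :
  (forall i, is_pmf (p i)) ->
  (forall i k a, f i (neg k) a = - f i k a) ->
  (forall i k a a', `|f i k a - f i k a'| <= 2) ->
  (forall k, \sum_i Ex (p i) (fun a => f i k a ^+ 2) <= v) ->
  0 <= l -> 8 * l ^+ 2 < 1 ->
  Ex (pprod p) (fun x => expR (l * (maxsum f x - Ex (pprod p) (maxsum f)))) <=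
  expR (l ^+ 2 * (2 * v + 16 * Ex (pprod p) (maxsum f)) / (1 - 8 * l ^+ 2)).
Proof.
move=> pP fN f2 fv l0 l1; have ppP := is_pmf_pprod pP.
have p2P := is_pmf_ppair pP; have pp2P := is_pmf_pprod p2P.
set W := Ex (pprod p) (maxsum f).
pose D i k (z : A * A) := f i k z.1 - f i k z.2.
pose g i k z := D i k z ^+ 2 / 4.
apply: (le_trans (mgf_symmetrization f pP l0)); rewrite Ex2E.
have maxsqrE (z : {ffun 'I_n -> A * A}) :
    maxsqr f [ffun i => (z i).1] [ffun i => (z i).2] = 4 * maxsum g z.
  rewrite /maxsqr /maxsum -(fmaxM k0 _ (ler0n R 4)); apply: eq_fmax => k.
  by rewrite mulr_sumr; apply: eq_bigr => i _; rewrite !ffunE /g /D; field.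
have g01 i k z : 0 <= g i k z <= 1.
  rewrite /g divr_ge0 ?sqr_ge0//= ler_pdivrMr// mul1r.
  rewrite -real_normK ?num_real//.
  have := f2 i k z.1 z.2; rewrite -/(D i k z) => h.
  have := normr_ge0 (D i k z); nra.
under eq_Ex do rewrite maxsqrE mulrA (mulrC _ 4).
have t1 : 2 * (4 * l ^+ 2) < 1 by lra.
have t0 : 0 <= 4 * l ^+ 2 by rewrite mulr_ge0// sqr_ge0.
apply: (le_trans (mgf_nonneg p2P g01 t0 t1)).
have -> : 2 * (4 * l ^+ 2) = 8 * l ^+ 2 by ring.
rewrite ler_expR ler_wpM2r ?invr_ge0 ?subr_ge0 ?(ltW l1)//.
rewrite [4 * _]mulrC -mulrA ler_wpM2l ?sqr_ge0//.
pose h i k z := D i k z ^+ 2.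
have -> : 4 * Ex (pprod (ppair p)) (maxsum g) = Ex (pprod (ppair p)) (maxsum h).
  rewrite -ExZ; apply: eq_Ex => z; rewrite /maxsum -(fmaxM k0 _ (ler0n R 4)).
  by apply: eq_fmax => k; rewrite mulr_sumr; apply: eq_bigr => i _; rewrite /g /h; field.
have hv k : \sum_i Ex (ppair p i) (h i k) <= 2 * v.
  apply: (@le_trans _ _ (\sum_i 2 * Ex (p i) (fun a => f i k a ^+ 2))); last first.
    by rewrite -mulr_sumr ler_wpM2l.
  apply: ler_sum => i _.
  have -> : Ex (ppair p i) (h i k) =
     Ex (p i) (fun a => Ex (p i) (fun a' => (f i k a - f i k a') ^+ 2)).
    rewrite /Ex; under [RHS]eq_bigr do rewrite mulr_sumr.
    by rewrite pair_big/=; apply: eq_bigr => z _; rewrite mulrA.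
  have -> : Ex (p i) (fun a => Ex (p i) (fun a' => (f i k a - f i k a') ^+ 2)) =
     2 * Ex (p i) (fun a => f i k a ^+ 2) - 2 * Ex (p i) (f i k) ^+ 2.
    transitivity (Ex (p i) (fun a => f i k a ^+ 2 + (- 2 * Ex (p i) (f i k)) * f i k a +
        Ex (p i) (fun a => f i k a ^+ 2))).
      apply: eq_Ex => a.
      transitivity (Ex (p i) (fun a' => f i k a ^+ 2 + (- 2 * f i k a) * f i k a' + f i k a' ^+ 2)).
        by apply: eq_Ex => a'; ring.
      rewrite !ExD (ExZ _ (- 2 * f i k a)) Ex_cst//; ring.
    rewrite !ExD (ExZ _ (- 2 * Ex (p i) (f i k))) Ex_cst//; ring.
  by rewrite gerBl// mulr_ge0// sqr_ge0.
apply: (le_trans (Ex_maxsum_le p2P hv)); rewrite lerD2l.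
suff : Ex (pprod (ppair p)) (fun z => Erad n (fun e =>
    fmax k0 (fun k => \sum_(i < n) sg e i * h i k (z i)))) <= 4 * (2 * W) by lra.
apply: (@le_trans _ _ (4 * Ex (pprod (ppair p)) (fun z => Erad n (fun e =>
    fmax k0 (fun k => \sum_(i < n) sg e i * D i k (z i)))))).
  rewrite -ExZ; apply: le_Ex => // z; rewrite -EradZ.
  apply: (@le_trans _ _ (Erad n (fun e =>
    fmax k0 (fun k => 0 + \sum_(i < n) sg e i * h i k (z i))))).
    by apply: le_Erad => e; apply: le_fmax => k; rewrite add0r.
  apply: (le_trans (Erad_contraction k0 (fun=> 0) (v := fun k i => 4 * D i k (z i)) _)).
    move=> i k k'; rewrite /h -mulrBr normrM ger0_norm// subr_sqr normrM.
    rewrite mulrC ler_wpM2r//; apply: (le_trans (ler_normD _ _)).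
    have := f2 i k (z i).1 (z i).2; have := f2 i k' (z i).1 (z i).2.
    rewrite -/(D i k (z i)) -/(D i k' (z i)); lra.
  apply: le_Erad => e; rewrite -(fmaxM k0 _ (ler0n R 4)); apply: le_fmax => k.
  rewrite add0r mulr_sumr; apply: ler_sum => i _; lra.
rewrite ler_wpM2l//.
have -> : Ex (pprod (ppair p)) (fun z => Erad n (fun e =>
    fmax k0 (fun k => \sum_(i < n) sg e i * D i k (z i)))) =
    Ex2 p (fun x x' => fmax k0 (fun k => \sum_i (f i k (x i) - f i k (x' i)))).
  rewrite Ex2_Erad Ex2E; apply: eq_Ex => z; apply: eq_Erad => e; apply: eq_fmax => k.
  apply: eq_bigr => i _; rewrite !ffunE /sg /D; case: nth; rewrite ?expr0 ?expr1; ring.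
apply: (@le_trans _ _ (Ex2 p (fun x x' => maxsum f x + maxsum f x'))).
  apply: le_Ex2 => // x x'; apply: fmax_le => k; rewrite sumrB lerD//.
    exact: (fmax_ge k0 (fun k => \sum_i f i k (x i))).
  rewrite -sumrN; under eq_bigr do rewrite -fN.
  exact: (fmax_ge k0 (fun k => \sum_i f i k (x' i))).
rewrite /Ex2; under eq_Ex do rewrite ExD Ex_cst//.
rewrite ExD Ex_cst// -/W; lra.
Qed.

End concentration.

(** * Deviations of suprema of empirical processes *)

Section bounded_expectation.
Context d (Omega : measurableType d) (R : realType) (P : probability Omega R).
Implicit Types f g : Omega -> R.

Lemma bounded_integrable f (M : R) : measurable_fun setT f -> (forall w, `|f w| <= M) ->
  P.-integrable setT (EFin \o f).
Proof.
move=> mf fM; apply: measurable_bounded_integrable => //.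
  exact: (le_lt_trans (probability_le1 P measurableT) (ltry 1)).
by exists M; split; [exact: num_real|move=> y My w _ /=; exact: le_trans (fM w) (ltW My)].
Qed.

Lemma Rintegral_prob_cst (c : R) : \int[P]_w c = c.
Proof.
rewrite Rintegral_cst// [X in fine X](_ : _ = 1%E) ?mulr1//.
exact: probability_setT.
Qed.

Lemma le_Rintegral_bounded f g (M : R) : measurable_fun setT f -> measurable_fun setT g ->
  (forall w, `|f w| <= M) -> (forall w, `|g w| <= M) ->
  (forall w, f w <= g w) -> \int[P]_w f w <= \int[P]_w g w.
Proof.
move=> mf mg fM gM fg.
by apply: le_Rintegral => //; [exact: (bounded_integrable mf fM)|exact: (bounded_integrable mg gM)].
Qed.

Lemma dist_Rintegral_bounded f g (M e : R) : measurable_fun setT f -> measurable_fun setT g ->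
  (forall w, `|f w| <= M) -> (forall w, `|g w| <= M) ->
  (forall w, `|f w - g w| <= e) -> `|\int[P]_w f w - \int[P]_w g w| <= e.
Proof.
move=> mf mg fM gM fg.
have fi := bounded_integrable mf fM; have gi := bounded_integrable mg gM.
rewrite -RintegralB//.
have mfg : measurable_fun setT (fun w => f w - g w) by exact: measurable_funB.
apply: (le_trans (le_normr_Rintegral _ _)) => //; first exact: (bounded_integrable mfg fg).
rewrite -[leRHS]Rintegral_prob_cst.
apply: (@le_Rintegral_bounded _ _ e) => //; first exact: measurableT_comp.
  by move=> w; rewrite normr_id.
move=> w; rewrite ger0_norm//; exact: le_trans (normr_ge0 _) (fg w).
Qed.

Lemma measurable_fun_finite_valued (A : finType) (Y : Omega -> A) (F : A -> R) :
  (forall a, measurable (Y @^-1` [set a])) -> measurable_fun setT (fun w => F (Y w)).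
Proof.
move=> mY _ B mB; rewrite setTI.
rewrite [X in measurable X](_ : _ = \bigcup_(a in [set a | B (F a)]) (Y @^-1` [set a])).
  by apply: fin_bigcup_measurable => // a _; exact: mY.
apply/seteqP; split => [w /= h|w [a /= h e]]; first by exists (Y w).
by rewrite /= e.
Qed.

Lemma Rintegral_finite_valued (A : finType) (Y : Omega -> A) (F : A -> R) :
  (forall a, measurable (Y @^-1` [set a])) ->
  \int[P]_w F (Y w) = Ex (fun a => fine (P (Y @^-1` [set a]))) F.
Proof.
move=> mY; rewrite /Rintegral.
have E w : (F (Y w))%:E = (\sum_(a <- enum A) (F a * \1_(Y @^-1` [set a]) w)%:E)%E.
  rewrite sumEFin; congr EFin; rewrite big_enum/= (bigD1 (Y w))//= big1.
    by rewrite indicE mem_set// mulr1 addr0.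
  by move=> a aY; rewrite indicE memNset ?mulr0//= => h; rewrite h eqxx in aY.
under eq_integral do rewrite E.
rewrite integral_sum//; last first.
  move=> a; apply: (@bounded_integrable (fun w => F a * \1_(Y @^-1` [set a]) w) `|F a|).
    by apply: measurable_funM => //; exact: measurable_indic.
  by move=> w; rewrite normrM ler_piMr// indicE; case: (_ \in _); rewrite ?normr1 ?normr0.
rewrite /Ex -big_enum/= -[RHS]/(fine (_)%:E) -sumEFin; congr fine; apply: eq_bigr => a _.
under eq_integral do rewrite EFinM.
rewrite integralZl//; last first.
  apply: (@bounded_integrable (\1_(Y @^-1` [set a])) 1); first exact: measurable_indic.
  by move=> w; rewrite indicE; case: (_ \in _); rewrite ?normr1 ?normr0.
by rewrite integral_indic// setIT EFinM muleC fineK// fin_num_measure.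
Qed.

Lemma measurable_fmax (K : finType) (k0 : K) (f : K -> Omega -> R) :
  (forall k, measurable_fun setT (f k)) ->
  measurable_fun setT (fun w => fmax k0 (fun k => f k w)).
Proof.
move=> mf; apply: (measurability _ (@RGenCInfty.measurableE R)) => //.
move=> _ [_ [x ->] <-]; rewrite setTI.
rewrite [X in measurable X](_ : _ = \bigcup_(k in setT) (f k @^-1` `[x, +oo[)).
  apply: fin_bigcup_measurable => // k _.
  by rewrite -[X in measurable X]setTI; exact: mf.
apply/seteqP; split => w /=.
  rewrite in_itv/= andbT => h; have [k e] := fmax_attained k0 (fun k => f k w).
  by exists k => //=; rewrite in_itv/= andbT -e.
move=> [k _ /=]; rewrite !in_itv/= !andbT => h.
exact: le_trans h (fmax_ge k0 (fun k => f k w) k).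
Qed.

Lemma is_pmf_distribution (A : finType) (Y : Omega -> A) :
  (forall a, measurable (Y @^-1` [set a])) ->
  is_pmf (fun a => fine (P (Y @^-1` [set a]))).
Proof.
move=> mY; split=> [a|]; first exact: fine_ge0.
have := Rintegral_finite_valued (fun=> 1) mY; rewrite Rintegral_prob_cst /Ex => ->.
by apply: eq_bigr => a _; rewrite mulr1.
Qed.

Lemma prob_finite_valued (A : finType) (Y : Omega -> A) (B : pred A) :
  (forall a, measurable (Y @^-1` [set a])) ->
  fine (P [set w | B (Y w)]) = Ex (fun a => fine (P (Y @^-1` [set a]))) (fun a => (B a)%:R).
Proof.
move=> mY; rewrite -Rintegral_finite_valued// /Rintegral.
congr fine.
have mB : measurable [set w | B (Y w)].
  have := measurable_fun_finite_valued (fun a => (B a)%:R) mY measurableT (measurable_set1 1).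
  rewrite setTI [X in measurable X](_ : _ = [set w | B (Y w)])//.
  apply/seteqP; split => w /=; last by move=> ->.
  by case: (B (Y w)) => //= /eqP; rewrite eq_sym oner_eq0.
have <- : (\int[P]_w (\1_[set w | B (Y w)] w)%:E = P [set w | B (Y w)])%E.
  by rewrite integral_indic// setIT.
apply: eq_integral => w _; congr EFin.
rewrite indicE; congr (_%:R); congr nat_of_bool.
by apply/idP/idP => [/set_mem//|h]; exact: mem_set.
Qed.

End bounded_expectation.

Unset Implicit Arguments.

(** * Rounding to a finite product space *)

Section discretization.
Context (R : realType) (n : nat) (d : 'I_n -> measure_display).
Context (T : forall i, measurableType (d i)).
Context (K : finType) (k0 : K) (g : forall i, K -> T i -> R).

Hypotheses (n_gt0 : (0 < n)%N) (g1 : forall i k x, `|g i k x| <= 1).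
Hypothesis mg : forall i k, measurable_fun setT (g i k).

(** A level records the rounded values at one point of all the functions indexed by [K]. This single
    finite alphabet replaces every [T i]. *)
Definition level : finType := {ffun K -> 'I_(n.*2).+1}.

(* Values in [[-1, 1]] are rounded down to multiples of [1 / n]. The error on a
   centered sum of [n] terms is at most 2, which the constants absorb, so no limit
   in the mesh is needed. *)
Definition disc i (x : T i) : level :=
  [ffun k => inord (Num.truncn (n%:R * (g i k x + 1)))].

Definition lval (a : level) (k : K) : R := (a k)%:R / n%:R - 1.

Let n_gt0R : 0 < n%:R :> R. Proof. by rewrite ltr0n. Qed.

Let ng_ge0 i k x : 0 <= n%:R * (g i k x + 1).
Proof.
by have := g1 i k x; rewrite ler_norml => /andP[h _]; rewrite mulr_ge0// -lerBlDr sub0r.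
Qed.

Let trunc_small i k x : (Num.truncn (n%:R * (g i k x + 1)) < (n.*2).+1)%N.
Proof.
rewrite ltnS -(ler_nat R).
have /andP[h _] := truncn_itv (ng_ge0 i k x); apply: (le_trans h).
have := g1 i k x; rewrite ler_norml => /andP[_ g2].
by rewrite -mul2n natrM mulrC ler_wpM2r//; lra.
Qed.

Lemma discE i x k : (disc i x k : nat) = Num.truncn (n%:R * (g i k x + 1)).
Proof. by rewrite ffunE inordK. Qed.

Lemma lval_bound a k : `|lval a k| <= 1.
Proof.
have : (a k)%:R <= 2 * n%:R :> R by rewrite -natrM ler_nat mul2n -ltnS.
rewrite -ler_pdivrMr// /lval ler_norml => h.
have : 0 <= (a k)%:R / n%:R :> R by rewrite divr_ge0.
by move=> h'; apply/andP; split; lra.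
Qed.

Lemma lval_disc i x k : `|lval (disc i x) k - g i k x| <= n%:R^-1.
Proof.
rewrite /lval discE; have /andP[h1 h2] := truncn_itv (ng_ge0 i k x).
rewrite (_ : _ - _ - _ = (Num.truncn (n%:R * (g i k x + 1)))%:R / n%:R - (g i k x + 1)); last by ring.
rewrite distrC ler_norml.
have : (Num.truncn (n%:R * (g i k x + 1)))%:R / n%:R <= g i k x + 1.
  by rewrite ler_pdivrMr// [leRHS]mulrC.
have : g i k x + 1 <= (Num.truncn (n%:R * (g i k x + 1))).+1%:R / n%:R.
  by rewrite ler_pdivlMr// [leLHS]mulrC ltW.
rewrite -natr1 mulrDl mul1r => h3 h4.
have : 0 <= n%:R^-1 :> R by rewrite invr_ge0.
by move=> h5; apply/andP; split; lra.
Qed.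

Lemma measurable_disc i a : measurable (disc i @^-1` [set a]).
Proof.
rewrite [X in measurable X](_ : _ = \bigcap_(k in setT)
   ((fun x => n%:R * (g i k x + 1)) @^-1` `[(a k)%:R, (a k).+1%:R[)).
  apply: fin_bigcap_measurable => // k _.
  rewrite -[X in measurable X]setTI.
  have mf : measurable_fun setT (fun x => n%:R * (g i k x + 1)).
    by apply: measurable_funM => //; apply: measurable_funD.
  exact: mf.
apply/seteqP; split => [x /= <- k _ /=|x h /=].
  by rewrite in_itv/= discE truncn_itv.
apply/ffunP => k; apply/val_inj; rewrite /= discE.
by have := h k I; rewrite /= in_itv/= => /truncn_def.
Qed.

Context (dO : measure_display) (Omega : measurableType dO).
Context (P : probability Omega R) (X : forall i, {mfun Omega >-> T i}).

Definition dvec (w : Omega) : {ffun 'I_n -> level} := [ffun i => disc i (X i w)].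

Definition dpmf i (a : level) : R := fine (P ((disc i \o X i) @^-1` [set a])).

Lemma measurable_disc_comp i a : measurable ((disc i \o X i) @^-1` [set a]).
Proof.
rewrite comp_preimage -[X in measurable X]setTI.
by apply: (measurable_funP (X i)) => //; exact: measurable_disc.
Qed.

Lemma measurable_dvec y : measurable (dvec @^-1` [set y]).
Proof.
rewrite [X in measurable X](_ : _ = \bigcap_(i in setT)
   ((disc i \o X i) @^-1` [set y i])).
  by apply: fin_bigcap_measurable => // i _; exact: measurable_disc_comp.
apply/seteqP; split => [w /= <- i _ /=|w h]; first by rewrite ffunE.
by apply/ffunP => i; rewrite ffunE; exact: (h i I).
Qed.

Lemma dvec_indep : independent_coordinates P X ->
  (fun y => fine (P (dvec @^-1` [set y]))) = pprod dpmf.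
Proof.
move=> ind; apply/funext => y.
have := ind [set: 'I_n]%SET (fun i => disc i @^-1` [set y i]) (fun i => measurable_disc i (y i)).
rewrite [Y in P Y](_ : _ = dvec @^-1` [set y]); last first.
  apply/seteqP; split => [w h|w /= <- i _]; last by rewrite ffunE.
  by apply/ffunP => i; rewrite ffunE; exact: (h i (finset.in_setT i)).
move=> ->; rewrite /pprod.
rewrite (eq_bigr (fun i => (dpmf i (y i))%:E)); last first.
  by move=> i _; rewrite fineK// fin_num_measure//; exact: measurable_disc_comp.
rewrite prodEFin/=; apply: eq_bigl => i; exact: finset.in_setT.
Qed.

Lemma is_pmf_dpmf i : is_pmf (dpmf i).
Proof. exact: (is_pmf_distribution P (measurable_disc_comp i)). Qed.

Lemma Rintegral_dvec (F : {ffun 'I_n -> level} -> R) : independent_coordinates P X ->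
  \int[P]_w F (dvec w) = Ex (pprod dpmf) F.
Proof.
by move=> ind; rewrite -dvec_indep// Rintegral_finite_valued//; exact: measurable_dvec.
Qed.

End discretization.

Set Implicit Arguments.
Arguments disc {R n d T K} g i x.
Arguments lval {R n K} a k.
Arguments dvec {R n d T K} g {dO Omega} X w.
Arguments dpmf {R n d T K} g {dO Omega} P X i a.
Arguments lval_bound {R n K}.
Arguments lval_disc {R n d T K g}.
Arguments is_pmf_dpmf {R n d T K g} _ _ {dO Omega} P X i.
Arguments measurable_dvec {R n d T K g} _ _ {dO Omega} X y.
Arguments dvec_indep {R n d T K g} _ _ {dO Omega P X}.
Arguments Rintegral_dvec {R n d T K g} _ _ {dO Omega P X} F.

Section deviation.

Lemma Ex_markov_expR (R : realType) (I : finType) (q : I -> R) (Z : I -> R) (l m B a : R) :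
  is_pmf q -> 0 <= l ->
  Ex q (fun x => expR (l * (Z x - m))) <= expR B ->
  Ex q (fun x => (a <= Z x)%R%:R) <= expR (- (l * (a - m)) + B).
Proof.
move=> qP l0 h; rewrite expRD; apply: le_trans (ler_wpM2l (expR_ge0 _) h).
rewrite -ExZ; apply: le_Ex => // x; rewrite -expRD.
case: (boolP (a <= Z x)) => [az|_]; last exact: expR_ge0.
rewrite -[leLHS]expR0 ler_expR.
have := ler_wpM2l l0 az; lra.
Qed.

Context (R : realType) (n : nat) (d : 'I_n -> measure_display).
Context (T : forall i, measurableType (d i)).
Context (dO : measure_display) (Omega : measurableType dO).
Context (P : probability Omega R) (X : forall i, {mfun Omega >-> T i}).

Definition deviation (g : forall i, T i -> R) (w : Omega) : R :=
  \sum_(i < n) (g i (X i w) - \int[P]_w' g i (X i w')).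

Lemma measurable_deviation (g : forall i, T i -> R) :
  (forall i, measurable_fun setT (g i)) -> measurable_fun setT (deviation g).
Proof.
move=> mg; apply: measurable_sum => i; apply: measurable_funB => //.
by apply: measurableT_comp.
Qed.

(** The finite inequality is applied to the rounded sample. Rounding changes the supremum by at most
    2, hence its mean by at most 2, which together turn [u] into [u - 4]; it also changes the sum of
    second moments by at most 2. *)
Lemma sup_deviation_tail (K : finType) (k0 : K) (g : K -> forall i, T i -> R) (v W l u : R) :
  (0 < n)%N -> independent_coordinates P X ->
  (forall k i x, `|g k i x| <= 1) ->
  (forall k i, measurable_fun setT (g k i)) ->
  (forall k, \sum_i \int[P]_w (g k i (X i w) ^+ 2) <= v) ->
  \int[P]_w fmax k0 (fun k => `|deviation (g k) w|) <= W ->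
  0 <= l -> 8 * l ^+ 2 < 1 ->
  fine (P [set w | u <= fmax k0 (fun k => `|deviation (g k) w|)]) <=
  expR (- (l * (u - 4 - W)) +
    l ^+ 2 * (2 * (v + 2) + 16 * (W + 2)) / (1 - 8 * l ^+ 2)).
Proof.
move=> n0 ind g1 mg gv gW l0 l1.
have aux (a b : R) : u <= b -> - 2 <= a - b -> u - 2 <= a by move=> *; lra.
pose g' i k := g k i.
have g1' i k x : `|g' i k x| <= 1 by exact: g1.
have mg' i k : measurable_fun setT (g' i k) by exact: mg.
have nR0 : 0 < n%:R :> R by rewrite ltr0n.
pose D := disc g'.
pose L := level n K.
pose val (a : L) k : R := lval a k.
pose Y : Omega -> {ffun 'I_n -> L} := dvec g' X.
pose p : 'I_n -> L -> R := dpmf g' P X.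
have YE w i : Y w i = D i (X i w) by rewrite /Y /dvec ffunE.
have pP i : is_pmf (p i) by exact: (is_pmf_dpmf g1' mg').
have ppP := is_pmf_pprod pP.
have mY y : measurable (Y @^-1` [set y]) by exact: (measurable_dvec g1' mg').
have EY F : \int[P]_w F (Y w) = Ex (pprod p) F.
  exact: (Rintegral_dvec g1' mg').
have mYi i : measurable_fun setT (fun w => X i w) by exact: measurable_funP.
have val1 a k : `|val a k| <= 1 by exact: lval_bound.
have valD w i k : `|val (Y w i) k - g k i (X i w)| <= n%:R^-1.
  by rewrite YE; exact: (lval_disc n0 g1').
have mgX k i : measurable_fun setT (fun w => g k i (X i w)).
  exact: (measurableT_comp (mg k i) (mYi i)).
have mF (F : {ffun 'I_n -> L} -> R) : measurable_fun setT (fun w => F (Y w)).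
  exact: measurable_fun_finite_valued.
pose m i k := Ex (p i) (fun a => val a k).
have mE i k : m i k = \int[P]_w val (Y w i) k.
  by rewrite (EY (fun y => val (y i) k)) (Ex_pprod_coord i (fun a => val a k) pP).
have mclose i k : `|m i k - \int[P]_w g k i (X i w)| <= n%:R^-1.
  rewrite mE; apply: (@dist_Rintegral_bounded _ _ _ _ _ _ 1) => //.
  exact: (mF (fun y => val (y i) k)).
(* The bit carries the sign, so that absolute values become a maximum over a class closed under
   [neg]. *)
pose f (i : 'I_n) (bk : bool * K) (a : L) : R := (-1) ^+ bk.1 * (val a bk.2 - m i bk.2).
pose neg (bk : bool * K) := (~~ bk.1, bk.2).
have fN i bk a : f i (neg bk) a = - f i bk a.
  by rewrite /f /neg/= signrN mulNr.
have f2 i bk a a' : `|f i bk a - f i bk a'| <= 2.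
  rewrite /f -mulrBr normrM normrX normrN1 expr1n mul1r.
  rewrite (_ : _ - _ - _ = val a bk.2 - val a' bk.2); last by ring.
  apply: (le_trans (ler_normB _ _)); have := val1 a bk.2; have := val1 a' bk.2; lra.
have fv bk : \sum_i Ex (p i) (fun a => f i bk a ^+ 2) <= v + 2.
  apply: (@le_trans _ _ (\sum_i (\int[P]_w (g bk.2 i (X i w) ^+ 2) + 2 * n%:R^-1))); last first.
    rewrite big_split/= lerD// sumr_const card_ord -[leLHS]mulr_natr -mulrA mulVf ?mulr1//.
    by rewrite gt_eqF.
  apply: ler_sum => i _.
  have -> : Ex (p i) (fun a => f i bk a ^+ 2) =
      Ex (p i) (fun a => val a bk.2 ^+ 2) - m i bk.2 ^+ 2.
    transitivity (Ex (p i) (fun a => val a bk.2 ^+ 2 + (- 2 * m i bk.2) * val a bk.2 + m i bk.2 ^+ 2)).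
      apply: eq_Ex => a; rewrite /f exprMn sqrr_sign; ring.
    rewrite !ExD (ExZ _ (- 2 * m i bk.2)) (Ex_cst (pP i)) -/(m i bk.2); ring.
  have -> : Ex (p i) (fun a => val a bk.2 ^+ 2) = \int[P]_w (val (Y w i) bk.2 ^+ 2).
    by rewrite (EY (fun y => val (y i) bk.2 ^+ 2)) (Ex_pprod_coord i (fun a => val a bk.2 ^+ 2) pP).
  have : `|\int[P]_w (val (Y w i) bk.2 ^+ 2) - \int[P]_w (g bk.2 i (X i w) ^+ 2)| <= 2 * n%:R^-1.
    apply: (@dist_Rintegral_bounded _ _ _ _ _ _ 1).
    - exact: (mF (fun y => val (y i) bk.2 ^+ 2)).
    - exact: measurable_funX.
    - by move=> w; rewrite normrX exprn_ile1.
    - by move=> w; rewrite normrX exprn_ile1.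
    move=> w; rewrite subr_sqr normrM mulrC ler_pM//.
    by apply: (le_trans (ler_normD _ _)); have := val1 (Y w i) bk.2; have := g1 bk.2 i (X i w); lra.
  have := sqr_ge0 (m i bk.2); rewrite ler_norml => ? /andP[_ ?]; lra.
pose kk0 := (true, k0).
pose Z w := fmax k0 (fun k => `|deviation (g k) w|).
pose M := maxsum kk0 f.
have MZ w : `|M (Y w) - Z w| <= 2.
  have dev2 k : `|\sum_i (val (Y w i) k - m i k) - deviation (g k) w| <= 2.
    rewrite /deviation -sumrB.
    apply: (le_trans (ler_norm_sum _ _ _)).
    apply: (@le_trans _ _ (\sum_(i < n) 2 * n%:R^-1)); last first.
      by rewrite sumr_const card_ord -[leLHS]mulr_natr -mulrA mulVf ?mulr1// gt_eqF.
    apply: ler_sum => i _.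
    rewrite (_ : _ - _ = (val (Y w i) k - g k i (X i w)) - (m i k - \int[P]_w' g k i (X i w'))); last by ring.
    apply: (le_trans (ler_normB _ _)); have := valD w i k; have := mclose i k; lra.
  have fE bk : \sum_i f i bk (Y w i) = (-1) ^+ bk.1 * \sum_i (val (Y w i) bk.2 - m i bk.2).
    by rewrite mulr_sumr.
  rewrite ler_norml; apply/andP; split.
    rewrite lerBrDr addrC lerBlDr /Z; apply: fmax_le => k.
    pose s := (\sum_i (val (Y w i) k - m i k) < 0)%R.
    have := fmax_ge kk0 (fun bk => \sum_i f i bk (Y w i)) (s, k).
    rewrite -/(maxsum kk0 f (Y w)) -/M fE/= -normrEsign => hM.
    have := dev2 k; have := ler_normB (\sum_i (val (Y w i) k - m i k))
      (\sum_i (val (Y w i) k - m i k) - deviation (g k) w).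
    rewrite (_ : _ - (_ - _) = deviation (g k) w); last by ring.
    lra.
  rewrite lerBlDr /M /maxsum; apply: fmax_le => bk; rewrite fE.
  apply: (le_trans (ler_norm _)); rewrite normrM normrX normrN1 expr1n mul1r.
  have := fmax_ge k0 (fun k => `|deviation (g k) w|) bk.2; rewrite -/(Z w) /= => hZ.
  have := dev2 bk.2; have := ler_normD (deviation (g bk.2) w)
      (\sum_i (val (Y w i) bk.2 - m i bk.2) - deviation (g bk.2) w).
  rewrite (_ : _ + (_ - _) = \sum_i (val (Y w i) bk.2 - m i bk.2)); last by ring.
  lra.
have mZ : measurable_fun setT Z.
  apply: measurable_fmax => k; apply: measurableT_comp => //.
  exact: measurable_deviation.
have Zb w : `|Z w| <= n%:R * 2.
  have dk k : `|deviation (g k) w| <= n%:R * 2.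
    apply: (le_trans (ler_norm_sum _ _ _)).
    apply: (@le_trans _ _ (\sum_(i < n) (2 : R))); last by rewrite sumr_const card_ord mulr_natl.
    apply: ler_sum => i _; apply: (le_trans (ler_normB _ _)).
    have : `|\int[P]_w' g k i (X i w')| <= 1.
      have := @dist_Rintegral_bounded _ _ _ P (fun w => g k i (X i w)) (fun=> 0) 1 1.
      rewrite Rintegral_prob_cst subr0; apply => //.
      - by move=> w'; rewrite normr0.
      - by move=> w'; rewrite subr0.
    by have := g1 k i (X i w); lra.
  by rewrite /Z; have [k ->] := fmax_attained k0 (fun k => `|deviation (g k) w|); rewrite normr_id.
have EM : Ex (pprod p) M <= W + 2.
  rewrite -EY; have := @dist_Rintegral_bounded _ _ _ P (fun w => M (Y w)) Z (n%:R * 2 + 2) 2.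
  have h1 := mF M.
  move=> /(_ h1 mZ); rewrite ler_norml => h.
  have /andP[_] : - 2 <= \int[P]_w M (Y w) - \int[P]_w Z w <= 2.
    apply: h => // w; last by apply: (le_trans (Zb w)); lra.
    have := ler_normD (Z w) (M (Y w) - Z w).
    rewrite (_ : Z w + (M (Y w) - Z w) = M (Y w)); last by ring.
    have := MZ w; have := Zb w; lra.
  move: gW; rewrite -/Z; lra.
have l1' : 0 < 1 - 8 * l ^+ 2 by rewrite subr_gt0.
have mgf := mgf_maxsum kk0 pP fN f2 fv l0 l1.
have mk := Ex_markov_expR (u - 2) ppP l0 mgf.
apply: (@le_trans _ _ (fine (P [set w | u - 2 <= M (Y w)]))).
  have mM : measurable [set w | u - 2 <= M (Y w)].
    have := mF M measurableT `[u - 2, +oo[%classic (measurable_itv _).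
    rewrite setTI [X in measurable X](_ : _ = [set w | u - 2 <= M (Y w)])//.
    by apply/seteqP; split => w /=; rewrite in_itv/= andbT.
  have mZu : measurable [set w | u <= Z w].
    have := mZ measurableT `[u, +oo[%classic (measurable_itv _).
    rewrite setTI [X in measurable X](_ : _ = [set w | u <= Z w])//.
    by apply/seteqP; split => w /=; rewrite in_itv/= andbT.
  apply: fine_le; rewrite ?fin_num_measure//.
  apply: le_measure; rewrite ?inE// => w /= uZ.
  have {}uZ : u <= Z w := uZ.
  have := MZ w; rewrite ler_norml => /andP[h _]; exact: aux uZ h.
rewrite (prob_finite_valued P (fun y => u - 2 <= M y) mY).
rewrite (_ : (fun a => fine _) = pprod p); last exact: (dvec_indep g1' mg').
apply: (le_trans mk); rewrite ler_expR; apply: lerD.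
  rewrite lerN2 ler_wpM2l//; move: EM; rewrite /M; lra.
rewrite ler_pM2r ?invr_gt0// ler_wpM2l ?sqr_ge0//; move: EM; rewrite /M; lra.
Qed.

End deviation.

(** * Hellinger distance and the test statistic *)

Section density_integral.
Context d (T : measurableType d) (R : realType).
Local Open Scope ereal_scope.
Import HBNNSimple.

(** The two sides agree on simple functions by the hypothesis on [nu], and both pass to increasing
    limits. *)
Lemma ge0_integral_density (mu nu : {measure set T -> \bar R}) (p : T -> R)
    (f : T -> \bar R) :
  measurable_fun setT p -> (forall x, (0 <= p x)%R) ->
  (forall A, measurable A -> nu A = \int[mu]_(x in A) (p x)%:E) ->
  measurable_fun setT f -> (forall x, 0 <= f x) ->
  \int[nu]_x f x = \int[mu]_x (f x * (p x)%:E).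
Proof.
move=> mp p0 nuE mf f0; pose h := nnsfun_approx measurableT mf.
have mpE : measurable_fun setT (EFin \o p) by exact/measurable_EFinP.
have hE n : \int[nu]_x (h n x)%:E = \int[mu]_x ((h n x)%:E * (p x)%:E).
  have hsum x : (h n x)%:E = \sum_(y \in range (h n)) (y * \1_(h n @^-1` [set y]) x)%:E.
    by rewrite fsumEFin//; congr EFin; exact: fimfunE.
  have mi y : measurable_fun setT (fun x => (y * \1_(h n @^-1` [set y]) x)%:E).
    exact/measurable_EFinP/measurable_funM.
  under eq_integral do rewrite hsum.
  under [RHS]eq_integral => x _.
    rewrite hsum ge0_mule_fsuml; last by move=> y; exact: nnfun_muleindic_ge0.
    over.
  rewrite ge0_integral_fsum//; last by move=> y x _; exact: nnfun_muleindic_ge0.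
  rewrite ge0_integral_fsum//; last 2 first.
  - by move=> y; exact: emeasurable_funM.
  - by move=> y x _; rewrite mule_ge0 ?lee_fin// -lee_fin; exact: nnfun_muleindic_ge0.
  apply: eq_fsbigr => y; rewrite inE => -[x0 _ y0].
  have y_ge0 : (0 <= y)%R by rewrite -y0.
  under eq_integral do rewrite EFinM.
  rewrite ge0_integralZl//; last first.
    by apply/measurable_EFinP; exact: measurable_indic.
  rewrite integral_indic// setIT nuE// integral_mkcond.
  under [RHS]eq_integral do rewrite EFinM -muleA.
  rewrite ge0_integralZl//; last 2 first.
  - by apply: emeasurable_funM => //; apply/measurable_EFinP; exact: measurable_indic.
  - by move=> x _; rewrite mule_ge0 ?lee_fin.
  congr (_ * _); apply: eq_integral => x _.
  by rewrite patchE indicE; case: ifP => _; rewrite ?mul1e ?mul0e.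
have fE x : f x = limn (EFin \o h ^~ x).
  by apply/esym/cvg_lim => //; exact: cvg_nnsfun_approx.
have ndh x m n : (m <= n)%N -> (h m x)%:E <= (h n x)%:E.
  by move=> mn; rewrite lee_fin; exact/lefP/nd_nnsfun_approx.
have mh n : measurable_fun setT (fun x => (h n x)%:E) by exact/measurable_EFinP.
transitivity (limn (fun n => \int[nu]_x (h n x)%:E)).
  rewrite -monotone_convergence//.
  - by apply: eq_integral => x _; exact: fE.
  - by move=> n x _; rewrite lee_fin.
  - by move=> x _ m n; exact: ndh.
under eq_fun do rewrite hE.
rewrite -monotone_convergence//.
- apply: eq_integral => x _; rewrite fE; apply/cvg_lim => //.
  by apply: cvgeZr => //; rewrite -fE; exact: cvg_nnsfun_approx.
- by move=> n; exact: emeasurable_funM.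
- by move=> n x _; rewrite mule_ge0 ?lee_fin.
- by move=> x _ m n mn; rewrite lee_wpmul2r ?lee_fin//; have := ndh x _ _ mn; rewrite lee_fin.
Qed.

End density_integral.

(** * Pointwise inequalities for the drift and the variance *)

Section pointwise.
Context (R : realType).

(* [psi (sqrt (b / a))] in closed form; when [a = b = 0] the division by 0 yields
   0, in accordance with [0 / 0 = 1] and [psi 1 = 0]. *)
Definition hpsi (a b : R) : R := (Num.sqrt b - Num.sqrt a) / Num.sqrt (a + b).

Lemma psi_eratioE (a b : R) : 0 <= a -> 0 <= b -> psi (sqrte (eratio b a)) = hpsi a b.
Proof.
move=> a0 b0; rewrite /eratio /hpsi; have [->|an0] := eqVneq a 0.
  have [->|bn0] := eqVneq b 0.
    by rewrite /psi/= sqrtr1 subrr mul0r sqrtr0 subrr mul0r.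
  by rewrite /= sqrtr0 subr0 add0r mulfV// sqrtr_eq0 -ltNge lt_neqAle eq_sym bn0.
have ap : 0 < a by rewrite lt_neqAle eq_sym an0.
rewrite /psi/= sqrtrM// sqrtrV// exprMn exprVn !sqr_sqrtr//.
have -> : 1 + b / a = (a + b) / a by field.
rewrite sqrtrM ?addr_ge0// sqrtrV//.
have sa : 0 < Num.sqrt a by rewrite sqrtr_gt0.
have sab : 0 < Num.sqrt (a + b) by rewrite sqrtr_gt0 ltr_wpDr.
by field; rewrite !gt_eqF.
Qed.

Lemma hpsiN a b : hpsi b a = - hpsi a b.
Proof. by rewrite /hpsi (addrC b) -mulNr opprB. Qed.

Lemma sqr_sqrt_dist (a b : R) : 0 <= a -> 0 <= b ->
  (Num.sqrt b - Num.sqrt a) ^+ 2 <= a + b.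
Proof.
move=> a0 b0; rewrite sqrrB !sqr_sqrtr//.
have := mulr_ge0 (sqrtr_ge0 b) (sqrtr_ge0 a); lra.
Qed.

Lemma hpsi_le1 (a b : R) : 0 <= a -> 0 <= b -> `|hpsi a b| <= 1.
Proof.
move=> a0 b0; rewrite /hpsi; have [s0|s0] := eqVneq (Num.sqrt (a + b)) 0.
  by rewrite s0 invr0 mulr0 normr0.
have sp : 0 < Num.sqrt (a + b) by rewrite lt_neqAle eq_sym s0 sqrtr_ge0.
rewrite normrM normfV (gtr0_norm sp) ler_pdivrMr// mul1r.
rewrite -ler_sqr ?nnegrE ?sqrtr_ge0// real_normK ?num_real// sqr_sqrtr ?addr_ge0//.
exact: sqr_sqrt_dist.
Qed.

Section with_midpoint.
Variables (a b c : R).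
Hypotheses (a0 : 0 <= a) (b0 : 0 <= b) (c0' : 0 <= c).
Let x := Num.sqrt a. Let y := Num.sqrt b. Let z := Num.sqrt c.
Let r := (a + b) / 2.
Let rr := Num.sqrt r.
Let q : R := (Num.sqrt 2)^-1.

Let r0 : 0 <= r. Proof. by rewrite divr_ge0// addr_ge0. Qed.
Let rr0 : 0 <= rr. Proof. exact: sqrtr_ge0. Qed.
Let x2 : x ^+ 2 = a. Proof. exact: sqr_sqrtr. Qed.
Let y2 : y ^+ 2 = b. Proof. exact: sqr_sqrtr. Qed.
Let z2 : z ^+ 2 = c. Proof. exact: sqr_sqrtr. Qed.
Let rr2 : rr ^+ 2 = (x ^+ 2 + y ^+ 2) / 2. Proof. by rewrite x2 y2 sqr_sqrtr. Qed.
Let s2 : 0 < Num.sqrt 2 :> R. Proof. by rewrite sqrtr_gt0. Qed.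
Let q0 : 0 < q. Proof. by rewrite invr_gt0. Qed.
Let q2 : q ^+ 2 = 2^-1. Proof. by rewrite exprVn sqr_sqrtr. Qed.

Lemma hpsi_midpoint : hpsi a b = q * (y - x) / rr.
Proof.
rewrite /hpsi -/x -/y (_ : a + b = 2 * r); last by rewrite /r; field.
rewrite sqrtrM// invfM -/rr -/q; ring.
Qed.

Let rr_ge : (x + y) / 2 <= rr.
Proof.
rewrite -ler_sqr ?nnegrE ?divr_ge0 ?addr_ge0 ?sqrtr_ge0// rr2.
have := sqr_ge0 (x - y); lra.
Qed.

Let dist_mid : (z - rr) ^+ 2 <= 2^-1 * (z - x) ^+ 2 + 2^-1 * (z - y) ^+ 2.
Proof.
rewrite !sqrrB rr2; have := ler_wpM2l (sqrtr_ge0 c : 0 <= z) rr_ge; lra.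
Qed.

(** Here [a], [b], [c] are values of the densities [t], [u], [s]. The term [2^-1 * (b - a)] is kept
    apart because it integrates to 0. The square root [rr] of the midpoint is at least the midpoint
    of the roots, so [(z - rr) ^+ 2] is at most the average of [(z - x) ^+ 2] and [(z - y) ^+ 2]. *)
Lemma hpsi_drift_le :
  2^-1 * (Num.sqrt (b * r) - Num.sqrt (a * r)) + q * (hpsi a b * c) <=
  2^-1 * (b - a) + ((1 + q) * (2^-1 * (z - x) ^+ 2) - (1 - q) * (2^-1 * (z - y) ^+ 2)).
Proof.
suff : 2^-1 * (Num.sqrt (b * r) - Num.sqrt (a * r)) + q * (hpsi a b * c) <=
    (y - x) * z + q * (z - rr) ^+ 2.
  move/le_trans; apply.
  have := ler_wpM2l (ltW q0) dist_mid; rewrite -x2 -y2; lra.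
rewrite (sqrtrM r b0) (sqrtrM r a0) -/x -/y -/rr hpsi_midpoint.
have [rr_eq0|rrn0] := eqVneq rr 0.
  have : x ^+ 2 + y ^+ 2 = 0 by have := rr2; rewrite rr_eq0 expr0n/=; lra.
  move/eqP; rewrite paddr_eq0 ?sqr_ge0// !sqrf_eq0 => /andP[/eqP-> /eqP->].
  rewrite rr_eq0 !(mulr0, mul0r, subrr, addr0, subr0, add0r).
  by rewrite mulr_ge0 ?sqr_ge0// ltW.
have rrp : 0 < rr by rewrite lt_neqAle eq_sym rrn0.
(* Since [q ^+ 2 = 1 / 2], the left-hand side is [(y - x) / (2 * rr)] times [rr ^+ 2 + z ^+ 2], and
   completing the square isolates the linear term in [z]. *)
have -> : 2^-1 * (y * rr - x * rr) + q * (q * (y - x) / rr * c) =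
    (y - x) * z + 2^-1 * ((y - x) / rr) * (z - rr) ^+ 2.
  rewrite -z2 (_ : q * (q * (y - x) / rr * z ^+ 2) = q ^+ 2 * (y - x) / rr * z ^+ 2); last by ring.
  by rewrite q2; field.
rewrite lerD2l ler_wpM2r ?sqr_ge0//.
have h : (y - x) / rr <= 2 * q.
  rewrite ler_pdivrMr//; have [yx|yx] := leP (y - x) 0.
    by apply: (le_trans yx); rewrite !mulr_ge0// ltW.
  rewrite -ler_sqr ?nnegrE ?(ltW yx) ?mulr_ge0 ?(ltW q0)// !exprMn q2 rr2.
  have := mulr_ge0 (sqrtr_ge0 a : 0 <= x) (sqrtr_ge0 b : 0 <= y).
  by rewrite sqrrB; lra.
lra.
Qed.

(** With [A] the bracket on the right, [hpsi ^+ 2 * rr ^+ 2 <= 2 * A] and [(z - rr) ^+ 2 <= A]; then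
    [c <= 2 * rr ^+ 2 + 2 * (z - rr) ^+ 2] and [|hpsi| <= 1] give [4 + 2]. *)
Lemma hpsi_sqr_le : hpsi a b ^+ 2 * c <=
  6 * (2^-1 * (z - x) ^+ 2 + 2^-1 * (z - y) ^+ 2).
Proof.
have p1 : hpsi a b ^+ 2 <= 1.
  by rewrite -[leLHS]real_normK ?num_real// exprn_ile1// hpsi_le1.
have pr : hpsi a b ^+ 2 * rr ^+ 2 <= (z - x) ^+ 2 + (z - y) ^+ 2.
  rewrite hpsi_midpoint; have [rr_eq0|rrn0] := eqVneq rr 0.
    by rewrite rr_eq0 expr0n/= mulr0 addr_ge0// sqr_ge0.
  rewrite -exprMn mulfVK// exprMn q2.
  have := sqr_ge0 (2 * z - x - y); lra.
have cz : c <= 2 * rr ^+ 2 + 2 * (z - rr) ^+ 2.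
  rewrite -z2; have := sqr_ge0 (z - 2 * rr); lra.
apply: (le_trans (ler_wpM2l (sqr_ge0 _) cz)).
have := ler_wpM2r (sqr_ge0 (z - rr)) p1; rewrite mul1r.
have := dist_mid; lra.
Qed.

End with_midpoint.
End pointwise.

Section coordinate.
Context d (T : measurableType d) (R : realType) (mu : {measure set T -> \bar R}).
Implicit Types (s t u : density mu) (f g : T -> R).

Let Imu f := mu.-integrable setT (EFin \o f).

Lemma dominated_integrable_fun f g : measurable_fun setT f ->
  (forall x, `|f x| <= g x) -> Imu g -> Imu f.
Proof.
move=> mf fg ig.
apply: (@le_integrable _ _ _ mu setT measurableT (EFin \o f) (EFin \o g)) => //.
  exact/measurable_EFinP.
by move=> x _ /=; rewrite lee_fin (le_trans (fg x))// ler_norm.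
Qed.

Lemma density_integrable t : Imu t.
Proof.
apply/integrableP; split; first exact/measurable_EFinP.
under eq_integral do rewrite /= ger0_norm ?dens_ge0//.
by rewrite dens_int1 ltry.
Qed.

Lemma Rintegral_density1 t : \int[mu]_x t x = 1.
Proof. by rewrite /Rintegral dens_int1. Qed.

Lemma integrableD_fun f g : Imu f -> Imu g -> Imu (fun x => f x + g x).
Proof. by move=> fi gi; have := integrableD measurableT fi gi. Qed.

Lemma integrableB_fun f g : Imu f -> Imu g -> Imu (fun x => f x - g x).
Proof. by move=> fi gi; have := integrableB measurableT fi gi. Qed.

Lemma integrableZ_fun (k : R) f : Imu f -> Imu (fun x => k * f x).
Proof. by move=> fi; have := integrableZl measurableT k fi. Qed.

Lemma measurable_sqrt f : measurable_fun setT f ->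
  measurable_fun setT (fun x => Num.sqrt (f x)).
Proof.
move=> mf; apply: (measurableT_comp _ mf); apply: continuous_measurable_fun.
exact: sqrt_continuous.
Qed.

Let mt t : measurable_fun setT t. Proof. exact: measurable_funP. Qed.

Lemma measurable_hpsi t u : measurable_fun setT (fun x => hpsi (t x) (u x)).
Proof.
apply: measurable_funM.
  by apply: measurable_funB; exact: measurable_sqrt.
rewrite (_ : (fun x => _) = (fun x => Num.sqrt (t x + u x) `^ (-1))); last first.
  by apply/funext => x; rewrite powR_inv1// sqrtr_ge0.
apply: (measurableT_comp (measurable_powR (-1))).
by apply: measurable_sqrt; exact: measurable_funD.
Qed.

Let hdist s t x := (Num.sqrt (s x) - Num.sqrt (t x)) ^+ 2.

Lemma hdist_integrable s t : Imu (hdist s t).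
Proof.
apply: (dominated_integrable_fun (g := fun x => s x + t x)); last first.
- by apply: integrableD_fun; exact: density_integrable.
- move=> x; rewrite ger0_norm ?sqr_ge0// addrC.
  by apply: sqr_sqrt_dist; exact: dens_ge0.
- by apply: measurable_funX; apply: measurable_funB; exact: measurable_sqrt.
Qed.

Lemma hell2_ge0 s t : 0 <= hell2 mu s t.
Proof. by rewrite mulr_ge0// Rintegral_ge0// => x _; exact: sqr_ge0. Qed.

Lemma hell2_sym s t : hell2 mu s t = hell2 mu t s.
Proof.
rewrite /hell2; congr (_ * _); congr fine; apply: eq_integral => x _; congr EFin.
by rewrite -sqrrN opprB.
Qed.

(** A quadratic form of the triangle inequality, whose free weight [e] survives summation over the
    coordinates. Optimizing [e] afterwards yields the triangle inequality for the product
    distance. *)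
Lemma hell2_quasi_triangle s t u (e : R) : 0 < e ->
  hell2 mu s u <= (1 + e) * hell2 mu s t + (1 + e^-1) * hell2 mu t u.
Proof.
move=> e0; rewrite /hell2 !(mulrCA (1 + _)) -mulrDr ler_wpM2l//.
rewrite -!RintegralZl//; try exact: hdist_integrable.
rewrite -RintegralD//; try (by apply: integrableZ_fun; exact: hdist_integrable).
apply: le_Rintegral => //; first exact: hdist_integrable.
  by apply: integrableD_fun; apply: integrableZ_fun; exact: hdist_integrable.
move=> x _; rewrite /=; move: (Num.sqrt (s x)) (Num.sqrt (t x)) (Num.sqrt (u x)) => a c b.
rewrite -subr_ge0.
have -> : (1 + e) * (a - c) ^+ 2 + (1 + e^-1) * (c - b) ^+ 2 - (a - b) ^+ 2 =
    (e * (a - c) - (c - b)) ^+ 2 / e by field; rewrite gt_eqF.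
by rewrite divr_ge0 ?sqr_ge0// ltW.
Qed.

Let hpsi_integrable s t u : Imu (fun x => hpsi (t x) (u x) * s x).
Proof.
apply: (dominated_integrable_fun (g := s)) (density_integrable s).
  by apply: measurable_funM => //; exact: measurable_hpsi.
move=> x; rewrite normrM (ger0_norm (dens_ge0 s x)) ler_piMl ?dens_ge0//.
by apply: hpsi_le1; exact: dens_ge0.
Qed.

Let geom_integrable t u : Imu (fun x => Num.sqrt (u x * ((t x + u x) / 2))).
Proof.
apply: (dominated_integrable_fun (g := fun x => t x + u x)); last first.
- by apply: integrableD_fun; exact: density_integrable.
- move=> x; rewrite ger0_norm ?sqrtr_ge0//.
  have tx := dens_ge0 t x; have ux := dens_ge0 u x.
  have tux : 0 <= t x + u x by exact: addr_ge0.
  rewrite -[leRHS](ger0_norm tux) -sqrtr_sqr ler_wsqrtr// expr2.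
  apply: ler_pM; [exact: ux|by apply: divr_ge0|by rewrite lerDr|].
  by rewrite ler_pdivrMr// ler_peMr// ler1n.
- apply: measurable_sqrt; apply: measurable_funM => //; apply: measurable_funM => //.
  exact: measurable_funD.
Qed.

Lemma drift_le s t u :
  2^-1 * (affinity mu u (fun x => (t x + u x) / 2) -
          affinity mu t (fun x => (t x + u x) / 2)) +
  (Num.sqrt 2)^-1 * \int[mu]_x (hpsi (t x) (u x) * s x) <=
  (1 + (Num.sqrt 2)^-1) * hell2 mu s t - (1 - (Num.sqrt 2)^-1) * hell2 mu s u.
Proof.
set q := (Num.sqrt 2)^-1.
rewrite /affinity /hell2.
have ig1 := geom_integrable t u.
have ig2 : Imu (fun x => Num.sqrt (t x * ((t x + u x) / 2))).
  have := geom_integrable u t; congr (Imu _).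
  by apply/funext => x; rewrite (addrC (u x)).
have ih := hdist_integrable.
have id := density_integrable.
have ip := hpsi_integrable s t u.
(* Both densities have mass 1; this null term restores the [2^-1 * (b - a)] of the pointwise
   bound. *)
have E1 : \int[mu]_x (2^-1 * (u x - t x)) = 0.
  rewrite RintegralZl//; last exact: integrableB_fun.
  by rewrite (RintegralB _ (id u) (id t))// !Rintegral_density1 subrr mulr0.
rewrite -(RintegralB _ ig1 ig2)// -RintegralZl//; last exact: integrableB_fun.
rewrite -(RintegralZl _ _ ip)// -RintegralD//; last 2 first.
- by apply: integrableZ_fun; exact: integrableB_fun.
- exact: integrableZ_fun.
rewrite -!RintegralZl//; try exact: ih; try (apply: integrableZ_fun; exact: ih).
have ih1 := integrableZ_fun (1 + q) (integrableZ_fun 2^-1 (ih s t)).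
have ih2 := integrableZ_fun (1 - q) (integrableZ_fun 2^-1 (ih s u)).
rewrite -(RintegralB _ ih1 ih2)// -[leRHS]add0r -E1 -RintegralD//; last 2 first.
- by apply: integrableZ_fun; exact: integrableB_fun.
- exact: integrableB_fun.
apply: le_Rintegral => //.
- apply: integrableD_fun; apply: integrableZ_fun => //; exact: integrableB_fun.
- apply: integrableD_fun; last exact: integrableB_fun.
  by apply: integrableZ_fun; exact: integrableB_fun.
move=> x _; exact: hpsi_drift_le (dens_ge0 t x) (dens_ge0 u x) (dens_ge0 s x).
Qed.

Lemma second_moment_le s t u :
  \int[mu]_x (hpsi (t x) (u x) ^+ 2 * s x) <= 6 * (hell2 mu s t + hell2 mu s u).
Proof.
have ih := hdist_integrable.
rewrite /hell2 -!RintegralZl//; try exact: ih.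
rewrite -RintegralD//; try (apply: integrableZ_fun; exact: ih).
rewrite -RintegralZl//; last by apply: integrableD_fun; apply: integrableZ_fun; exact: ih.
apply: le_Rintegral => //.
- apply: (dominated_integrable_fun (g := s)) (density_integrable s).
    by apply: measurable_funM => //; apply: measurable_funX; exact: measurable_hpsi.
  move=> x; rewrite normrM (ger0_norm (dens_ge0 s x)) ler_piMl ?dens_ge0//.
  by rewrite normrX exprn_ile1// hpsi_le1// dens_ge0.
- by apply: integrableZ_fun; apply: integrableD_fun; apply: integrableZ_fun; exact: ih.
move=> x _; exact: hpsi_sqr_le (dens_ge0 t x) (dens_ge0 u x) (dens_ge0 s x).
Qed.

End coordinate.

(** The weight [b / a] turns the right-hand side into [(a + b) ^+ 2]; both numbers are first
    enlarged slightly so that this ratio is defined and positive. *)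
Lemma le_add_of_quasi_triangle (R : realType) (x a b : R) : 0 <= a -> 0 <= b ->
  (forall e, 0 < e -> x ^+ 2 <= (1 + e) * a ^+ 2 + (1 + e^-1) * b ^+ 2) -> x <= a + b.
Proof.
move=> a0 b0 h; apply/ler_addgt0Pr => e e0.
pose a' := a + e / 2; pose b' := b + e / 2.
have a'0 : 0 < a' by rewrite ltr_wpDl// divr_gt0.
have b'0 : 0 < b' by rewrite ltr_wpDl// divr_gt0.
have -> : a + b + e = a' + b' by rewrite /a' /b'; field.
have ab0 : 0 <= a' + b' by rewrite addr_ge0// ltW.
have [x0|x0] := leP x 0; first exact: le_trans x0 ab0.
rewrite -ler_sqr ?nnegrE ?(ltW x0)//; apply: (le_trans (h (b' / a') (divr_gt0 b'0 a'0))).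
apply: (@le_trans _ _ ((1 + b' / a') * a' ^+ 2 + (1 + (b' / a')^-1) * b' ^+ 2)).
  have a2 : a ^+ 2 <= a' ^+ 2.
    by rewrite ler_sqr ?nnegrE ?(ltW a'0)// /a' lerDl divr_ge0// ltW.
  have b2 : b ^+ 2 <= b' ^+ 2.
    by rewrite ler_sqr ?nnegrE ?(ltW b'0)// /b' lerDl divr_ge0// ltW.
  have q0 : 0 <= b' / a' by rewrite divr_ge0// ltW.
  by apply: lerD; rewrite ler_wpM2l// addr_ge0// invr_ge0.
rewrite le_eqVlt; apply/orP; left; apply/eqP; field.
by rewrite !gt_eqF.
Qed.

Section hellinger_geometry.
Context (R : realType) (n : nat) (d : 'I_n -> measure_display).
Context (T : forall i, measurableType (d i)).
Variable mu : forall i, {measure set (T i) -> \bar R}.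
Implicit Types s t u : densities mu.

Lemma hellinger2_ge0 s t : 0 <= hellinger2 s t.
Proof. by apply: sumr_ge0 => i _; exact: hell2_ge0. Qed.

Lemma hellinger2_sym s t : hellinger2 s t = hellinger2 t s.
Proof. by apply: eq_bigr => i _; exact: hell2_sym. Qed.

Lemma hellinger_sym s t : hellinger s t = hellinger t s.
Proof. by rewrite /hellinger hellinger2_sym. Qed.

Lemma hellinger_ge0 s t : 0 <= hellinger s t.
Proof. exact: sqrtr_ge0. Qed.

Lemma hellinger_sqr s t : hellinger s t ^+ 2 = hellinger2 s t.
Proof. by rewrite sqr_sqrtr// hellinger2_ge0. Qed.

Lemma hellinger_triangle t s u : hellinger s u <= hellinger s t + hellinger t u.
Proof.
apply: le_add_of_quasi_triangle; rewrite ?hellinger_ge0// => e e0.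
rewrite !hellinger_sqr /hellinger2 !mulr_sumr -big_split/=.
by apply: ler_sum => i _; exact: hell2_quasi_triangle.
Qed.

Lemma psi_ratioE t u i (x : T i) : psi_ratio t u x = hpsi (t i x) (u i x).
Proof. by rewrite /psi_ratio psi_eratioE// dens_ge0. Qed.

(** This lets the one-sided bound [test_stat_le] be used twice, for the supremum at [sbar] and for
    the statistic from a near minimizer to [sbar]. *)
Lemma test_stat_anti (x : forall i, T i) t u : test_stat x u t = - test_stat x t u.
Proof.
rewrite /test_stat opprD -!mulrN -!sumrN.
congr (_ * _ + _ * _); apply: eq_bigr => i _.
  by rewrite opprB; congr (_ - _); congr affinity; apply/funext => y; rewrite addrC.
by rewrite !psi_ratioE hpsiN.
Qed.

End hellinger_geometry.

Section random_sample.
Context (R : realType) (n : nat) (d : 'I_n -> measure_display).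
Context (T : forall i, measurableType (d i)).
Variable mu : forall i, {measure set (T i) -> \bar R}.
Context (dO : measure_display) (Omega : measurableType dO).
Context (P : probability Omega R) (X : forall i, {mfun Omega >-> T i}).
Variable s : densities mu.
Hypothesis Xs : has_densities P X s.
Implicit Types t u : densities mu.

Lemma ge0_integral_sample i (f : T i -> R) : measurable_fun setT f ->
  (forall x, 0 <= f x) ->
  (\int[P]_w (f (X i w))%:E = \int[mu i]_x (f x * s i x)%:E)%E.
Proof.
move=> mf f0.
have mfE : measurable_fun setT (EFin \o f) by exact/measurable_EFinP.
have nuE A : measurable A -> distribution P (X i) A = (\int[mu i]_(x in A) (s i x)%:E)%E.
  by move=> mA; exact: Xs.
have := ge0_integral_density (measurable_funP (s i)) (dens_ge0 (s i)) nuE mfE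
  (fun x => f0 x : (0 <= (f x)%:E)%E).
by rewrite ge0_integral_distribution.
Qed.

Lemma Rintegral_sample i (f : T i -> R) : measurable_fun setT f ->
  (forall x, `|f x| <= 1) ->
  \int[P]_w f (X i w) = \int[mu i]_x (f x * s i x).
Proof.
move=> mf f1.
have mfX : measurable_fun setT (fun w => f (X i w)) by exact: measurableT_comp.
(* Adding 1 reduces to the nonnegative case; the added constant integrates to 1 under [P] and under
   the density. *)
have f1' x : 0 <= f x + 1 by have := f1 x; rewrite ler_norml => /andP[]; lra.
have mf1 : measurable_fun setT (fun x => f x + 1) by exact: measurable_funD.
have := @ge0_integral_sample i (fun x => f x + 1) mf1 f1'.
move/(congr1 fine).
have fi := @bounded_integrable _ _ _ P _ 1 mfX (fun w => f1 (X i w)).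
have ci : P.-integrable setT (EFin \o (fun=> 1 : R)).
  by apply: (@bounded_integrable _ _ _ P _ 1) => // w; rewrite normr1.
rewrite -[LHS]/(\int[P]_w (f (X i w) + 1)) -[RHS]/(\int[mu i]_x ((f x + 1) * s i x)).
rewrite RintegralD// Rintegral_prob_cst.
have fsi : (mu i).-integrable setT (EFin \o (fun x => f x * s i x)).
  apply: (dominated_integrable_fun (g := s i)) (density_integrable (s i)).
    by apply: measurable_funM.
  move=> x; rewrite normrM (ger0_norm (dens_ge0 _ _)) ler_piMl ?dens_ge0//.
have -> : \int[mu i]_x ((f x + 1) * s i x) = \int[mu i]_x (f x * s i x + s i x).
  by congr fine; apply: eq_integral => x _; rewrite mulrDl mul1r.
rewrite (RintegralD _ fsi (density_integrable (s i)))// Rintegral_density1.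
exact: addIr.
Qed.

Lemma ZprocE t u w : Zproc P X t u w =
  deviation P X (fun i x => hpsi (t i x) (u i x)) w.
Proof.
apply: eq_bigr => i _; rewrite /sample psi_ratioE; congr (_ - _).
rewrite unlock /Rintegral; congr fine; apply: eq_integral => w' _.
by rewrite psi_ratioE.
Qed.

Lemma test_stat_le t u w : test_stat (sample X w) t u <=
  (1 + (Num.sqrt 2)^-1) * hellinger2 s t - (1 - (Num.sqrt 2)^-1) * hellinger2 s u
  + (Num.sqrt 2)^-1 * Zproc P X t u w.
Proof.
rewrite ZprocE /deviation sumrB mulrBr /test_stat.
have -> : \sum_(i < n) psi_ratio t u (sample X w i) =
    \sum_(i < n) hpsi (t i (X i w)) (u i (X i w)).
  by apply: eq_bigr => i _; rewrite psi_ratioE.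
rewrite [leRHS]addrA lerBrDr [leLHS]addrAC lerD2r.
rewrite /hellinger2 !mulr_sumr -sumrB -big_split/=; apply: ler_sum => i _.
rewrite (@Rintegral_sample i (fun x => hpsi (t i x) (u i x))); last 2 first.
- exact: measurable_hpsi.
- by move=> x; rewrite hpsi_le1// dens_ge0.
exact: drift_le.
Qed.

Lemma sum_second_moment_le t u :
  \sum_i \int[P]_w (hpsi (t i (X i w)) (u i (X i w)) ^+ 2) <=
  6 * (hellinger2 s t + hellinger2 s u).
Proof.
rewrite /hellinger2 -big_split/= mulr_sumr; apply: ler_sum => i _.
rewrite (@Rintegral_sample i (fun x => hpsi (t i x) (u i x) ^+ 2)).
- exact: second_moment_le.
- by apply: measurable_funX; exact: measurable_hpsi.
- by move=> x; rewrite normrX exprn_ile1// hpsi_le1// dens_ge0.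
Qed.

End random_sample.

(** The integral of a nonnegative function is a supremum over the simple functions below it, so it
    is monotone even for nonmeasurable integrands. It serves for [wmod], whose integrand is a
    supremum over a ball of [S]. *)
Lemma ge0_le_integral_sup d (T : measurableType d) (R : realType)
    (mu : {measure set T -> \bar R}) (f g : T -> \bar R) :
  (forall x, 0 <= f x)%E -> (forall x, f x <= g x)%E ->
  (\int[mu]_x f x <= \int[mu]_x g x)%E.
Proof.
move=> f0 fg; have g0 x : (0 <= g x)%E by exact: le_trans (f0 x) (fg x).
rewrite !ge0_integralTE//; apply: le_ereal_sup => _ [h hf <-].
by exists h => // x; exact: le_trans (hf x) (fg x).
Qed.

(** * Peeling *)

Section peeling.
Context (R : realType) (n : nat) (d : 'I_n -> measure_display).
Context (T : forall i, measurableType (d i)).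
Variable mu : forall i, {measure set (T i) -> \bar R}.
Context (dO : measure_display) (Omega : measurableType dO).
Context (P : probability Omega R) (X : forall i, {mfun Omega >-> T i}).
Variable s : densities mu.
Hypotheses (n_gt0 : (0 < n)%N) (Xs : has_densities P X s).
Hypothesis Xind : independent_coordinates P X.
Variable S : set (densities mu).
Variable sbar : densities mu.
Implicit Types t : densities mu.

Let q : R := (Num.sqrt 2)^-1.

(** Both bounds come from the convergent [99 / 70] of [sqrt 2]; they are sharp enough for all the
    numerical comparisons. *)
Lemma invsqrt2_bounds : (70 / 99 < q) * (q < 99 / 140).
Proof.
have s2 : 0 < Num.sqrt 2 :> R by rewrite sqrtr_gt0.
have q0 : 0 < q by rewrite invr_gt0.
have q2 : q ^+ 2 = 2^-1 by rewrite exprVn sqr_sqrtr.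
split.
  by rewrite -ltr_sqr ?nnegrE ?divr_ge0 ?(ltW q0)// q2; lra.
by rewrite -ltr_sqr ?nnegrE ?divr_ge0 ?(ltW q0)// q2; lra.
Qed.

Lemma c0E : c0 = 8%:R^-1 * (1 - q) :> R. Proof. by []. Qed.

Definition hradius t := hellinger2 s t + hellinger2 s sbar.

Lemma hradius_ge0 t : 0 <= hradius t.
Proof. by rewrite addr_ge0// hellinger2_ge0. Qed.

Definition hdev t w : R := deviation P X (fun i x => hpsi (sbar i x) (t i x)) w.

Lemma measurable_hdev t : measurable_fun setT (hdev t).
Proof. by apply: measurable_deviation => i; exact: measurable_hpsi. Qed.

Lemma Ddim_ge1 : (1 <= Ddim P X S s sbar)%E.
Proof. by rewrite /Ddim le_max lexx orbT. Qed.

Lemma wmod_le (D y : R) : Ddim P X S s sbar = D%:E -> 0 <= y -> D < y ^+ 2 ->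
  (wmod P X S s sbar y <= (c0 * y ^+ 2)%:E)%E.
Proof.
move=> DE y0 Dy; rewrite leNgt; apply/negP => h.
suff : ((y ^+ 2)%:E <= D%:E)%E by rewrite lee_fin leNgt Dy.
rewrite -DE /Ddim le_max; apply/orP; left.
have yb : (y%:E <= ybar P X S s sbar)%E.
  rewrite /ybar /esup0; case: ifPn => [/eqP/seteqP[/(_ y%:E) e _]|_].
    by case: e; exists y.
  by apply: ereal_sup_ubound; exists y.
rewrite EFin_expe !expe2; apply: lee_pmul => //; rewrite lee_fin//.
Qed.

Lemma finite_sup_le (K : finType) (k0 : K) (tau : K -> densities mu) (y D : R) :
  Ddim P X S s sbar = D%:E -> 0 <= y -> D < y ^+ 2 ->
  (forall k, S (tau k)) -> (forall k, hradius (tau k) <= y ^+ 2) ->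
  \int[P]_w fmax k0 (fun k => `|hdev (tau k) w|) <= c0 * y ^+ 2.
Proof.
move=> DE y0 Dy Stau rtau.
have := wmod_le DE y0 Dy.
have F0 w : 0 <= fmax k0 (fun k => `|hdev (tau k) w|).
  exact: le_trans (normr_ge0 _) (fmax_ge k0 (fun k => `|hdev (tau k) w|) k0).
have : (\int[P]_w (fmax k0 (fun k => `|hdev (tau k) w|))%:E <= wmod P X S s sbar y)%E.
  apply: ge0_le_integral_sup => w; first by rewrite lee_fin.
  have [k ->] := fmax_attained k0 (fun k => `|hdev (tau k) w|).
  have hk : [set `|Zproc P X sbar t w|%:E | t in hball S s sbar y] `|hdev (tau k) w|%:E.
    by exists (tau k); [split; [exact: Stau|exact: rtau]|rewrite ZprocE].
  rewrite /esup0; case: ifPn => [/eqP e|_]; first by rewrite e in hk.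
  exact: ereal_sup_ubound.
move=> h1 h2; have h := le_trans h1 h2.
rewrite /Rintegral -lee_fin fineK//.
rewrite ge0_fin_numE; first exact: le_lt_trans h (ltry _).
by apply: integral_ge0 => w _; rewrite lee_fin.
Qed.

Lemma shell_tail (K : finType) (k0 : K) (tau : K -> densities mu) (y D x : R) :
  Ddim P X S s sbar = D%:E -> 0 <= y -> D + 40 * 100 <= y ^+ 2 -> 0 <= D ->
  (forall k, S (tau k)) -> (forall k, hradius (tau k) <= y ^+ 2) ->
  fine (P [set w | 11 / 5 * c0 * y ^+ 2 + 300 * x <=
                   fmax k0 (fun k => `|hdev (tau k) w|)]) <= expR (- x).
Proof.
move=> DE y0 Dy D0 Stau rtau.
have Dy' : D < y ^+ 2 by lra.
have W := finite_sup_le k0 DE y0 Dy' Stau rtau.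
(* This value meets two demands: the slope 300 in [x], times [q], stays below [kappa], and the
   variance term, about [(12.6 / 300) * y^2], stays below the [(6 / 5) * c0 * y^2] by which the
   threshold exceeds the bound on the mean. What is left when [y^2 >= 4000] absorbs the additive
   constants. *)
pose l : R := 300^-1.
have l0 : 0 <= l by rewrite /l; lra.
have l1 : 8 * l ^+ 2 < 1 by rewrite /l; lra.
have V k : \sum_i \int[P]_w (hpsi (sbar i (X i w)) (tau k i (X i w)) ^+ 2) <= 6 * y ^+ 2.
  apply: (le_trans (sum_second_moment_le Xs sbar (tau k))).
  by rewrite ler_wpM2l// addrC; exact: rtau.
have := @sup_deviation_tail R n d T dO Omega P X K k0
  (fun k i x => hpsi (sbar i x) (tau k i x)) (6 * y ^+ 2) (c0 * y ^+ 2) l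
  (11 / 5 * c0 * y ^+ 2 + 300 * x) n_gt0 Xind.
move=> /(_ _ _ V W l0 l1) h.
apply: (le_trans (h _ _)).
- by move=> k i z; apply: hpsi_le1; exact: dens_ge0.
- by move=> k i; exact: measurable_hpsi.
rewrite ler_expR c0E; have [q1 q2] := invsqrt2_bounds.
move: (y ^+ 2) Dy => Y Dy.
have Y4 : 40 * 100 <= Y by lra.
have l2 : 0 < 1 - 8 * l ^+ 2 by rewrite subr_gt0.
rewrite -lerBrDl ler_pdivrMr// /l.
have c1 : 36 / (10 * 100) * Y <= (8%:R^-1 * (1 - q)) * Y by rewrite ler_wpM2r//; lra.
have c2 : (8%:R^-1 * (1 - q)) * Y <= 37 / (10 * 100) * Y by rewrite ler_wpM2r//; lra.
lra.
Qed.

End peeling.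

Section uniform_control.
Context (R : realType) (n : nat) (d : 'I_n -> measure_display).
Context (T : forall i, measurableType (d i)).
Variable mu : forall i, {measure set (T i) -> \bar R}.
Context (dO : measure_display) (Omega : measurableType dO).
Context (P : probability Omega R) (X : forall i, {mfun Omega >-> T i}).
Variable s : densities mu.
Hypotheses (n_gt0 : (0 < n)%N) (Xs : has_densities P X s).
Hypothesis Xind : independent_coordinates P X.
Variables (S : set (densities mu)) (sbar : densities mu) (D : R).
Hypotheses (Ssbar : S sbar) (DE : Ddim P X S s sbar = D%:E).
Implicit Types t : densities mu.

Let q : R := (Num.sqrt 2)^-1.

Let D_ge1 : 1 <= D.
Proof. by rewrite -lee_fin -DE; exact: Ddim_ge1. Qed.

(* [4 * c0 = (1 - q) / 2] is half of the coefficient of [hellinger2 s t] in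
   [test_stat_le]. The constant [27 / 20] leads to [7 / 5] in [oracle_bound], which
   leaves [1 / 20] out of [145 / 100] for points that only nearly attain the infimum
   over [sbar]. *)
Definition exceeds xi t : set Omega := [set w |
  4 * c0 * hradius s sbar t + D / 8 + kappa * (27 / 20 + xi) <
  q * `|hdev P X sbar t w|].

Lemma measurable_exceeds xi t : measurable (exceeds xi t).
Proof.
have mf : measurable_fun setT (fun w => q * `|hdev P X sbar t w|).
  apply: measurable_funM => //; apply: measurableT_comp => //.
  exact: measurable_hdev.
have := mf measurableT `]4 * c0 * hradius s sbar t + D / 8 + kappa * (27 / 20 + xi), +oo[%classic
  (measurable_itv _).
rewrite setTI [X in measurable X](_ : _ = exceeds xi t)//.
by apply/seteqP; split => w /=; rewrite in_itv/= andbT.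
Qed.

Let c0_bounds : (41 / (112 * 10) <= c0 :> R) * (c0 <= 29 / 792 :> R).
Proof. by rewrite c0E; have [q1 q2] := invsqrt2_bounds R; split; lra. Qed.

(** On the innermost shell [r] may vanish, so [D / 8 + kappa * (27 / 20 + xi)] alone must exceed [q]
    times the threshold. The constant parts are about 482 against 440. *)
Let first_shell (xi r z : R) : 0 <= xi -> 0 <= r ->
  4 * c0 * r + D / 8 + kappa * (27 / 20 + xi) < q * z ->
  11 / 5 * c0 * (D + 40 * 100) + 300 * (xi + 1) <= z.
Proof.
move=> xi0 r0 h; rewrite leNgt; apply/negP => zu; move: h; apply/negP; rewrite -leNgt.
have [q1 q2] := invsqrt2_bounds R; rewrite -/q in q1 q2.
have [c1 c2] := c0_bounds; have D1 := D_ge1.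
have D0 : 0 <= D + 40 * 100 by lra.
set u := 11 / 5 * c0 * (D + 40 * 100) + 300 * (xi + 1) in zu.
have cD : c0 * (D + 40 * 100) <= 29 / 792 * (D + 40 * 100) by exact: ler_wpM2r.
have cD0 : 0 <= c0 * (D + 40 * 100) by rewrite mulr_ge0//; lra.
have u0 : 0 <= u by rewrite /u; lra.
have q0 : 0 <= q by lra.
have h1 : q * z <= q * u by rewrite ler_wpM2l// ltW.
have h2 : q * u <= 99 / 140 * u by rewrite ler_wpM2r// ltW.
have h3 : 0 <= c0 * r by rewrite mulr_ge0//; lra.
apply: (le_trans h1); apply: (le_trans h2); rewrite /u /kappa; lra.
Qed.

(** Here [E] is [2 ^ j] and the squared radii lie between [E] and [2 * E] times [D + 4000]. As
    [22 / 5 * q < 4], the term [4 * c0 * r] beats the part of the threshold proportional to the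
    squared radius with a surplus of order [E], and [2 * j <= E] lets this surplus pay for
    [300 * j]. *)
Let next_shell (xi r z E j : R) : 0 <= xi -> 0 <= j -> 2 * j <= E -> 1 <= E ->
  E * (D + 40 * 100) <= r ->
  4 * c0 * r + D / 8 + kappa * (27 / 20 + xi) < q * z ->
  11 / 5 * c0 * (2 * E * (D + 40 * 100)) + 300 * (xi + (j + 2)) <= z.
Proof.
move=> xi0 j0 jE E1 Er h; rewrite leNgt; apply/negP => zu; move: h; apply/negP; rewrite -leNgt.
have [q1 q2] := invsqrt2_bounds R; rewrite -/q in q1 q2.
have [c1 c2] := c0_bounds; have D1 := D_ge1.
set u := 11 / 5 * c0 * (2 * E * (D + 40 * 100)) + 300 * (xi + (j + 2)) in zu.
set Y := E * (D + 40 * 100) in Er.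
have Y4 : 40 * 100 * E <= Y.
  by rewrite /Y mulrC ler_wpM2l//; lra.
have uE : u = 22 / 5 * (c0 * Y) + 300 * (xi + (j + 2)) by rewrite /u /Y; ring.
have cY : 41 / (112 * 10) * Y <= c0 * Y by rewrite ler_wpM2r//; lra.
have cr : c0 * Y <= c0 * r by rewrite ler_wpM2l//; lra.
have u0 : 0 <= u by rewrite uE; lra.
have q0 : 0 <= q by lra.
have h1 : q * z <= q * u by rewrite ler_wpM2l// ltW.
have h2 : q * u <= 99 / 140 * u by rewrite ler_wpM2r// ltW.
apply: (le_trans h1); apply: (le_trans h2); rewrite uE /kappa; lra.
Qed.

Let sum_geometric (xi : R) (J : nat) :
  \sum_(j < J) expR (- (xi + (j%:R + 1))) <= expR (- xi) * (1 - 2^-1 ^+ J).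
Proof.
have e1 : expR (- 1) <= 2^-1 :> R.
  by rewrite expRN lef_pV2 ?posrE ?expR_gt0//; exact: expR_ge1Dx.
have ej (j : nat) : expR (- (j%:R + 1)) <= 2^-1 ^+ j.+1 :> R.
  by rewrite natr1 -mulrN1 expRM_natl lerXn2r ?nnegrE ?expR_ge0 ?invr_ge0.
elim: J => [|J IH]; first by rewrite big_ord0 expr0 subrr mulr0.
rewrite big_ord_recr/= opprD expRD.
have := ler_wpM2l (expR_ge0 (- xi)) (ej J); rewrite exprS; lra.
Qed.

Lemma finite_peeling (K : finType) (k0 : K) (tau : K -> densities mu) (xi : R) :
  0 <= xi -> (forall k, S (tau k)) ->
  (P (\bigcup_(k in [set: K]) exceeds xi (tau k)) <= (expR (- xi))%:E)%E.
Proof.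
move=> xi0 Stau; pose Y0 : R := D + 40 * 100; have D1 := D_ge1.
have Y01 : 1 <= Y0 by rewrite /Y0; lra.
pose rad k := hradius s sbar (tau k).
have ex k : exists j : nat, rad k <= 2 ^+ j * Y0.
  exists (Num.truncn (rad k)).+1.
  have /andP[_ h] := truncn_itv (hradius_ge0 s sbar (tau k)).
  apply: (le_trans (ltW h)); apply: (@le_trans _ _ (2 ^+ (Num.truncn (rad k)).+1)).
    by rewrite -natrX ler_nat ltnW// ltn_expl.
  by rewrite ler_peMr// exprn_ge0.
pose jk k : nat := ex_minn (ex k).
have jkP k : rad k <= 2 ^+ jk k * Y0 by rewrite /jk; case: ex_minnP.
have jk_min k j : (j < jk k)%N -> 2 ^+ j * Y0 <= rad k.
  rewrite /jk; case: ex_minnP => m _ mmin jm; rewrite leNgt; apply/negP => h.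
  by have := mmin j (ltW h); rewrite leqNgt jm.
pose y j : R := Num.sqrt (2 ^+ j * Y0).
have Yj0 j : 0 <= 2 ^+ j * Y0 by rewrite mulr_ge0 ?exprn_ge0//; lra.
have y2 j : y j ^+ 2 = 2 ^+ j * Y0 by rewrite sqr_sqrtr.
(* Shell [j] gets the level [xi + j + 1]. As [expR (- 1) <= 1 / 2], the probabilities of all shells
   add up to at most [expR (- xi)]. *)
pose u j : R := 11 / 5 * c0 * y j ^+ 2 + 300 * (xi + (j%:R + 1)).
(* Points outside the shell of [k1] are replaced by that of [k1]: the family stays indexed by [K],
   with all squared radii bounded on that shell. *)
pose tau' k1 k := if jk k == jk k1 then tau k else tau k1.
pose A j : set Omega := if [pick k | jk k == j] is Some k1 then
  [set w | u j <= fmax k0 (fun k => `|hdev P X sbar (tau' k1 k) w|)] else set0.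
have mA j : measurable (A j).
  rewrite /A; case: pickP => [k1 _|_]; last exact: measurable0.
  have mf : measurable_fun setT (fun w => fmax k0 (fun k => `|hdev P X sbar (tau' k1 k) w|)).
    apply: measurable_fmax => k; apply: measurableT_comp => //.
    exact: measurable_hdev.
  have := mf measurableT `[u j, +oo[%classic (measurable_itv _).
  rewrite setTI; congr measurable.
  by apply/seteqP; split => w /=; rewrite in_itv/= andbT.
have PA j : (P (A j) <= (expR (- (xi + (j%:R + 1))))%:E)%E.
  rewrite -[leLHS]fineK ?fin_num_measure// lee_fin.
  move: (mA j); rewrite /A; case: pickP => [k1 /eqP k1j mAj|_ _]; last by rewrite measure0/= expR_ge0.
  apply: (@shell_tail _ _ _ _ _ _ _ P X s n_gt0 Xs Xind S sbar K k0 (tau' k1) (y j) D) => //.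
  - exact: sqrtr_ge0.
  - by rewrite y2 -/Y0 ler_peMl ?exprn_ege1 ?ler1n//; lra.
  - by lra.
  - by move=> k; rewrite /tau'; case: ifP.
  - move=> k; rewrite y2 -k1j /tau'; case: ifP => [/eqP <-|_]; exact: jkP.
pose J := (\max_k jk k).+1.
apply: (@le_trans _ _ (\sum_(j < J) P (A j))%E).
  apply: content_subadditive => //.
    by apply: fin_bigcup_measurable => // k _; exact: measurable_exceeds.
  move=> w [k _ kw]; rewrite -bigcup_mkord.
  exists (jk k); first by rewrite /= /J ltnS; exact: (leq_bigmax k).
  rewrite /A; case: pickP => [k1 /eqP k1k|/(_ k)]; last by rewrite eqxx.
  rewrite /=; apply: le_trans (fmax_ge k0 (fun k => `|hdev P X sbar (tau' k1 k) w|) k).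
  rewrite /tau' k1k eqxx /u y2; move: kw; rewrite /exceeds/= -/(rad k).
  case: (jk k) (jkP k) (jk_min k) => [_ _|j _ jm] kw.
    rewrite expr0 mul1r add0r; apply: first_shell kw => //; exact: hradius_ge0.
  have E1 : 1 <= 2 ^+ j :> R by rewrite exprn_ege1// ler1n.
  rewrite exprS (_ : j.+1%:R + 1 = j%:R + 2 :> R); last by rewrite -natr1; ring.
  apply: next_shell kw => //; last exact: jm.
  rewrite -natrM -natrX ler_nat; case: (j) => // i.
  by rewrite expnS leq_mul2l/= ltn_expl.
apply: (@le_trans _ _ (\sum_(j < J) (expR (- (xi + (j%:R + 1))))%:E)%E).
  by apply: lee_sum => j _; exact: PA.
rewrite sumEFin lee_fin; apply: (le_trans (sum_geometric xi J)).
by rewrite ler_piMr ?expR_ge0// gerBl exprn_ge0.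
Qed.

(** The bound for finite families does not depend on their size, so it passes to the limit along an
    enumeration of [S], in which the indices that are not reached are sent to [sbar]. *)
Lemma uniform_control xi : 0 <= xi -> countable S ->
  measurable (\bigcup_(t in S) exceeds xi t) /\
  (P (\bigcup_(t in S) exceeds xi t) <= (expR (- xi))%:E)%E.
Proof.
move=> xi0 /countable_injP[f finj].
pose tk k : densities mu :=
  if pselect (exists t, S t /\ f t = k) is left e then projT1 (cid e) else sbar.
have Stk k : S (tk k) by rewrite /tk; case: pselect => // e; case: cid => t [].
have tkf t : S t -> tk (f t) = t.
  move=> St; rewrite /tk; case: pselect => [e|]; last by case; exists t.
  case: cid => u [Su fu]/=; apply: finj => //; exact/mem_set.
pose B m := \bigcup_(k in [set: 'I_m.+1]) exceeds xi (tk k).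
have BE : \bigcup_(t in S) exceeds xi t = \bigcup_m B m.
  apply/seteqP; split => [w [t St tw]|w [m _ [k _ kw]]]; last by exists (tk k).
  by exists (f t) => //; exists ord_max => //=; rewrite tkf.
have mB m : measurable (B m).
  by apply: fin_bigcup_measurable => // k _; exact: measurable_exceeds.
have mUB : measurable (\bigcup_m B m) by exact: bigcupT_measurable.
rewrite BE; split => //.
have ndB : nondecreasing_seq B.
  move=> a b ab; rewrite subsetEset => w [k _ kw].
  by exists (widen_ord (ab : (a.+1 <= b.+1)%N) k).
have cB := nondecreasing_cvg_mu (mu := P) mB mUB ndB.
rewrite -(cvg_lim (@ereal_hausdorff R) cB).
apply: lime_le; first by apply/cvg_ex; eexists; exact: cB.
by apply: nearW => m; exact: (finite_peeling ord0 xi0 (fun k => Stk k)).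
Qed.

End uniform_control.

(** * Risk bounds *)

Section good_event.
Context (R : realType) (n : nat) (d : 'I_n -> measure_display).
Context (T : forall i, measurableType (d i)).
Variable mu : forall i, {measure set (T i) -> \bar R}.
Context (dO : measure_display) (Omega : measurableType dO).
Context (P : probability Omega R) (X : forall i, {mfun Omega >-> T i}).
Variable s : densities mu.
Hypothesis Xs : has_densities P X s.
Variables (S : set (densities mu)) (sbar : densities mu) (D xi : R).
Hypotheses (Ssbar : S sbar).
Implicit Types t : densities mu.

Let q : R := (Num.sqrt 2)^-1.

Lemma sqrt2E : Num.sqrt 2 = 2 * q :> R.
Proof.
have s2 : 0 < Num.sqrt 2 :> R by rewrite sqrtr_gt0.
by rewrite -[X in X * _](@sqr_sqrtr R 2)// expr2 mulfK// gt_eqF.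
Qed.

Lemma hellinger_dist_ge0 t : (0 <= hellinger_dist t S)%E.
Proof. by apply: le_ereal_inf_tmp => _ [u _ <-]; rewrite lee_fin hellinger_ge0. Qed.

Lemma hellinger_dist_le t u : S u -> (hellinger_dist t S <= (hellinger t u)%:E)%E.
Proof. by move=> Su; apply: ereal_inf_lbound; exists u. Qed.

Lemma hellinger_dist_fin : hellinger_dist s S \is a fin_num.
Proof.
rewrite ge0_fin_numE ?hellinger_dist_ge0//.
exact: le_lt_trans (hellinger_dist_le s Ssbar) (ltry _).
Qed.

Definition dist2 : R := fine (hellinger_dist s S) ^+ 2.

Lemma dist2E : (hellinger_dist s S ^+ 2 = dist2%:E)%E.
Proof. by rewrite EFin_expe fineK// hellinger_dist_fin. Qed.

Lemma dist2_le t : S t -> dist2 <= hellinger2 s t.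
Proof.
move=> St; rewrite -hellinger_sqr /dist2 ler_sqr ?nnegrE ?hellinger_ge0 ?fine_ge0 ?hellinger_dist_ge0//.
by rewrite -lee_fin fineK ?hellinger_dist_fin// hellinger_dist_le.
Qed.

Definition oracle_bound : R :=
  c1 * hellinger2 s sbar - dist2 + c2 * D + c3 * (7 / 5 + xi).

Section fixed_outcome.
Variable w : Omega.
Hypothesis good : forall t, S t -> ~ exceeds P X s sbar D xi t w.

Let B' : R := D / 8 + kappa * (27 / 20 + xi).

Let good' t : S t -> q * `|Zproc P X sbar t w| <=
  2^-1 * (1 - q) * (hellinger2 s t + hellinger2 s sbar) + B'.
Proof.
move=> St; rewrite ZprocE; have /negP := good St; rewrite -leNgt /hdev /hradius c0E -/q /B'; lra.
Qed.

Let q_gt0 : 0 < q. Proof. by rewrite invr_gt0 sqrtr_gt0. Qed.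
Let q2 : q ^+ 2 = 2^-1. Proof. by rewrite exprVn sqr_sqrtr. Qed.

Let upsilonE t : upsilon (sample X w) S t =
  ereal_sup [set (test_stat (sample X w) t t')%:E | t' in S].
Proof.
rewrite /upsilon /esup0; case: ifPn => // /eqP/seteqP[h _].
by case: (h (test_stat (sample X w) t sbar)%:E); exists sbar.
Qed.

(** For a near minimizer [t], the statistic from [t] to [sbar] is at most the supremum at [t], hence
    at most [U + kappa / 10]. Read backwards by antisymmetry, this bounds from below the statistic
    from [sbar] to [t], whose upper bound decreases with [hellinger2 s t]. *)
Lemma near_minimizer_le t : near_minimizers (sample X w) S t ->
  hellinger2 s t <= oracle_bound.
Proof.
move=> [St]; set x := sample X w => ht.
have /(le_trans ht) {}ht : (ereal_inf [set upsilon x S u | u in S] + (kappa / 10)%:E <=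
    upsilon x S sbar + (kappa / 10)%:E)%E.
  by rewrite leeD2r//; apply: ereal_inf_lbound; exists sbar.
pose U : R := (1 + q + 2^-1 * (1 - q)) * hellinger2 s sbar - 2^-1 * (1 - q) * dist2 + B'.
have q1 : q < 99 / 140 := (invsqrt2_bounds R).2.
have Ub : (upsilon x S sbar <= U%:E)%E.
  rewrite upsilonE; apply: ge_ereal_sup => _ [t' St' <-]; rewrite lee_fin.
  apply: (le_trans (test_stat_le Xs sbar t' w)); rewrite -/q /U.
  have := good' St'; have := ler_wpM2l (ltW q_gt0) (ler_norm (Zproc P X sbar t' w)).
  have b0 : 0 <= 2^-1 * (1 - q) by rewrite mulr_ge0//; lra.
  have := ler_wpM2l b0 (dist2_le St').
  lra.
have Lb : ((test_stat x t sbar)%:E <= upsilon x S t)%E.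
  by rewrite upsilonE; apply: ereal_sup_ubound; exists sbar.
have : ((test_stat x t sbar)%:E <= U%:E + (kappa / 10)%:E)%E.
  by apply: (le_trans Lb); apply: (le_trans ht); rewrite leeD2r.
rewrite -EFinD lee_fin test_stat_anti => h.
have := test_stat_le Xs sbar t w; rewrite -/q -/x => h2.
have h3 := good' St.
have h4 := ler_wpM2l (ltW q_gt0) (ler_norm (Zproc P X sbar t w)).
have key : 2^-1 * (1 - q) * hellinger2 s t <=
    (2 * (1 + q) + (1 - q)) * hellinger2 s sbar - 2^-1 * (1 - q) * dist2 +
    2 * B' + kappa / 10.
  move: h h2 h3 h4; rewrite /U; lra.
(* Since [q ^+ 2 = 1 / 2], the factor [4 * (1 + q)] is the inverse of [(1 - q) / 2]. Multiplying by
   it yields [c1 = 12 + 16 * q + 4 * q ^+ 2], then [c2] from [2 * D / 8] and [c3] from [2 * kappa];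
   the tolerance [kappa / 10] becomes [c3 / 20] and raises [27 / 20] to [7 / 5]. *)
have c2E : 4 * (1 + q) * (2^-1 * (1 - q)) = 1.
  rewrite (_ : 4 * (1 + q) * (2^-1 * (1 - q)) = 2 * (1 - q ^+ 2)); last by field.
  by rewrite q2; field.
have p0 : 0 <= 4 * (1 + q) by rewrite mulr_ge0// addr_ge0// ltW.
have := ler_wpM2l p0 key; rewrite [leLHS]mulrA c2E mul1r => /le_trans; apply.
rewrite le_eqVlt; apply/orP; left; apply/eqP.
rewrite /oracle_bound /c1 sqrt2E /c3 /c2 -/q.
rewrite (_ : 4 * (1 + q) * _ = 4 * (1 + q) * (2 * (1 + q) + (1 - q)) * hellinger2 s sbar
  - 4 * (1 + q) * (2^-1 * (1 - q)) * dist2 + 4 * (1 + q) * (2 * B' + kappa / 10)); last by ring.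
rewrite c2E (_ : 4 * (1 + q) * (2 * (1 + q) + (1 - q)) = 12 + 16 * q + 4 * q ^+ 2); last by ring.
by rewrite q2 /B'; field.
Qed.

Lemma closure_le t : hellinger_closure (near_minimizers (sample X w) S) t ->
  hellinger2 s t <= oracle_bound.
Proof.
move=> ht; pose E := near_minimizers (sample X w) S.
have near e : 0 < e -> exists2 u, E u & hellinger t u < e.
  move=> e0; have : (hellinger_dist t E < e%:E)%E by rewrite ht lte_fin.
  by move=> /ereal_inf_lt[_ [u Eu <-]]; rewrite lte_fin => h; exists u.
have OB0 : 0 <= oracle_bound.
  have [u Eu _] := near 1 ltr01.
  exact: le_trans (hellinger2_ge0 s u) (near_minimizer_le Eu).
rewrite -hellinger_sqr -(sqr_sqrtr OB0) ler_sqr ?nnegrE ?hellinger_ge0 ?sqrtr_ge0//.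
apply/ler_addgt0Pr => e e0; have [u Eu ue] := near e e0.
apply: (le_trans (hellinger_triangle u s t)); apply: lerD.
  by rewrite /hellinger ler_wsqrtr// near_minimizer_le.
by rewrite hellinger_sym ltW.
Qed.

End fixed_outcome.
End good_event.

Section loss.
Context (R : realType) (n : nat) (d : 'I_n -> measure_display).
Context (T : forall i, measurableType (d i)).
Variable mu : forall i, {measure set (T i) -> \bar R}.
Context (dO : measure_display) (Omega : measurableType dO).
Context (X : forall i, {mfun Omega >-> T i}).
Variable s : densities mu.
Variable shat : (forall i, T i) -> densities mu.

Definition loss (w : Omega) : R := hellinger2 s (shat (sample X w)).

Lemma measurable_sample (A : set (forall i, T i)) :
  <<s @coordinate_cylinders n d T >> A -> measurable (sample X @^-1` A).
Proof.
move: A; apply: smallest_sub.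
  split.
  - by rewrite /= preimage_set0; exact: measurable0.
  - by move=> A mA /=; rewrite setTD preimage_setC; exact: measurableC.
  - by move=> F mF /=; rewrite preimage_bigcup; exact: bigcupT_measurable.
move=> _ [i [A mA ->]] /=.
by have := measurable_funP (X i) measurableT _ mA; rewrite setTI.
Qed.

(** By the triangle inequality, the sets where [hellinger2 s] exceeds a constant are open for the
    pseudo-metric, and [estimator_measurable] applies to them. *)
Lemma measurable_loss : estimator_measurable shat -> measurable_fun setT loss.
Proof.
move=> mshat; apply: (measurability _ (@RGenOInfty.measurableE R)) => //.
move=> _ [_ [c ->] <-]; rewrite setTI.
pose U := [set t : densities mu | c < hellinger2 s t].
have oU : hellinger_open U.
  move=> t /= ct; have [c_lt0|c_ge0] := ltP c 0.
    by exists 1 => // u _; rewrite /U/=; exact: lt_le_trans c_lt0 (hellinger2_ge0 s u).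
  exists (hellinger s t - Num.sqrt c).
    by rewrite subr_gt0 ltr_sqrt//; exact: le_lt_trans ct.
  move=> u tu; rewrite /U/= -hellinger_sqr -[ltLHS](sqr_sqrtr c_ge0).
  rewrite ltr_sqr ?nnegrE ?sqrtr_ge0//.
  have := hellinger_triangle u s t; rewrite (hellinger_sym u t) => h.
  rewrite -(ltrD2r (hellinger t u)) addrC; apply: lt_le_trans h.
  by move: tu; rewrite ltrBrDr.
have := measurable_sample (mshat U oU); congr measurable.
by apply/seteqP; split => w /=; rewrite in_itv/= andbT.
Qed.

Lemma hell2_le1 i (t u : densities mu) : hell2 (mu i) (t i) (u i) <= 1.
Proof.
rewrite /hell2 -[leRHS](@mulVf _ 2)// ler_wpM2l//.
have := @le_Rintegral _ _ _ (mu i) setT (fun x => (Num.sqrt (t i x) - Num.sqrt (u i x)) ^+ 2)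
  (fun x => t i x + u i x) measurableT (hdist_integrable (t i) (u i))
  (integrableD_fun (density_integrable (t i)) (density_integrable (u i))).
rewrite (RintegralD _ (density_integrable (t i)) (density_integrable (u i)))//.
rewrite !Rintegral_density1; apply => x _.
by rewrite /= [leRHS]addrC; apply: sqr_sqrt_dist; exact: dens_ge0.
Qed.

(** Boundedness keeps the layer sums below finite; [n] enters none of the constants. *)
Lemma loss_le w : loss w <= n%:R.
Proof.
rewrite /loss /hellinger2 (le_trans (ler_sum _ (fun i _ => hell2_le1 i _ _)))//.
by rewrite sumr_const card_ord.
Qed.

Lemma loss_ge0 w : 0 <= loss w.
Proof. exact: hellinger2_ge0. Qed.

End loss.

(** * Moments from exponential tails *)

Section exponential_tail.
Context d (Omega : measurableType d) (R : realType) (P : probability Omega R).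
Variables (Y : Omega -> R) (M : R).
Hypotheses (mY : measurable_fun setT Y) (Y0 : forall w, 0 <= Y w).
Hypothesis YM : forall w, Y w <= M.
Hypothesis Ytail : forall x : R, 0 < x -> (P [set w | (x < Y w)%R] <= (expR (- x))%:E)%E.

Let mYgt (x : R) : measurable [set w | x < Y w].
Proof.
have := @mY measurableT `]x, +oo[%classic (measurable_itv _); rewrite setTI.
by congr measurable; apply/seteqP; split => w /=; rewrite in_itv/= andbT.
Qed.

Let tail0 (x : R) : 0 <= x -> (P [set w | (x < Y w)%R] <= (expR (- x))%:E)%E.
Proof.
rewrite le_eqVlt => /predU1P[<-|]; last exact: Ytail.
by rewrite oppr0 expR0; exact: probability_le1.
Qed.

(** A layer-cake bound with finitely many layers: [F] lies below a step function of [Y] that jumps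
    at multiples of [e], so only the tails at these points are needed. *)
Lemma step_expectation_le (c e : R) (a : nat -> R) (N : nat) (F : Omega -> R) :
  0 <= c -> 0 <= e -> (forall k, 0 <= a k) ->
  measurable_fun setT F -> (forall w, 0 <= F w) ->
  (forall w, F w <= c + \sum_(k < N) a k * (k%:R * e < Y w)%R%:R) ->
  (\int[P]_w (F w)%:E <= (c + \sum_(k < N) a k * expR (- (k%:R * e)))%:E)%E.
Proof.
move=> c0 e0 a0 mF F0 FY.
pose A (k : nat) := [set w | k%:R * e < Y w].
have mAk k : measurable (A k) by exact: mYgt.
have AE k w : (k%:R * e < Y w)%R%:R = \1_(A k) w :> R.
  by rewrite indicE; congr (_%:R); congr nat_of_bool; apply/idP/idP => [h|/set_mem//]; exact/mem_set.
apply: (@le_trans _ _ (\int[P]_w (c%:E + \sum_(k < N) (a k)%:E * (\1_(A k) w)%:E))%E).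
  apply: ge0_le_integral_sup => w; first by rewrite lee_fin.
  apply: (@le_trans _ _ (c + \sum_(k < N) a k * (k%:R * e < Y w)%R%:R)%:E); first by rewrite lee_fin.
  rewrite EFinD -sumEFin leeD2l//; apply: lee_sum => k _.
  by rewrite AE EFinM.
have mA k : measurable_fun setT (fun w => ((a k)%:E * (\1_(A k) w)%:E)%E).
  by apply: emeasurable_funM => //; apply/measurable_EFinP; apply: measurable_indic.
rewrite ge0_integralD//; last 2 first.
- by move=> w _; apply: sume_ge0 => k _; rewrite mule_ge0// lee_fin.
- exact: emeasurable_sum.
have -> : (\int[P]_w c%:E = c%:E)%E.
  rewrite integral_cst// [X in (_ * X)%E](_ : _ = 1%E) ?mule1//.
  exact: probability_setT.
rewrite EFinD leeD2l// ge0_integral_sum//; last first.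
  by move=> k w _; rewrite mule_ge0// lee_fin.
rewrite -sumEFin; apply: lee_sum => k _; rewrite ge0_integralZl ?lee_fin//; last first.
  by apply/measurable_EFinP; apply: measurable_indic.
rewrite integral_indic// setIT EFinM lee_wpmul2l ?lee_fin//.
by apply: tail0; rewrite mulr_ge0.
Qed.

Let geometric (e : R) N : 0 < e -> \sum_(k < N) expR (- (k%:R * e)) <= (1 + e) / e.
Proof.
move=> e0; set x := expR (- e).
have xE k : expR (- (k%:R * e)) = x ^+ k by rewrite -mulrN expRM_natl.
have x1 : x <= (1 + e)^-1.
  by rewrite /x expRN lef_pV2 ?posrE ?expR_gt0 ?addr_gt0//; exact: expR_ge1Dx.
have e1 : 0 < 1 + e by rewrite addr_gt0.
have x0 : 0 <= x := expR_ge0 _.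
have h : e / (1 + e) <= 1 - x.
  rewrite lerBrDr -lerBrDl (_ : 1 - e / (1 + e) = (1 + e)^-1)//.
  by field; rewrite gt_eqF.
under eq_bigr do rewrite xE.
rewrite -[leRHS]invf_div -[leRHS]div1r ler_pdivlMr ?divr_gt0//.
apply: (@le_trans _ _ ((\sum_(k < N) x ^+ k) * (1 - x))).
  by rewrite ler_wpM2l// sumr_ge0// => k _; exact: exprn_ge0.
by rewrite mulrC -opprB mulNr -subrX1 opprB gerBl exprn_ge0.
Qed.

Let steps (e : R) : 0 < e -> exists N : nat, forall w, Y w <= N%:R * e.
Proof.
move=> e0; exists (Num.truncn (`|M| / e)).+1 => w.
have M0 : 0 <= `|M| / e by rewrite divr_ge0 ?normr_ge0 ?(ltW e0).
have /andP[_ /ltW] := truncn_itv M0; rewrite ler_pdivrMr//; apply: le_trans.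
by apply: (le_trans (YM w)); exact: ler_norm.
Qed.

(** Layers of width [1 / 20] give [1 + 1 / 20], which is exactly the gap between [29 / 20] in the
    tail bound and [5 / 2] in [c4]. *)
Lemma expectation_exponential_tail : (\int[P]_w (Y w)%:E <= (21 / 20)%:E)%E.
Proof.
pose e : R := 20^-1.
have e0 : 0 < e by rewrite /e invr_gt0.
have [N YN] := steps e0.
have step w m : Num.min (Y w) (m%:R * e) <= 0 + \sum_(k < m) e * (k%:R * e < Y w)%R%:R.
  rewrite add0r; elim: m => [|m IH]; first by rewrite big_ord0 mul0r ge_min lexx orbT.
  rewrite big_ord_recr/=; have [h|h] := ltP (m%:R * e) (Y w).
    rewrite mulr1; apply: (le_trans _ (lerD IH (lexx e))).
    rewrite (min_idPr (ltW h)) -natr1 mulrDl mul1r.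
    by rewrite ge_min lexx orbT.
  by rewrite mulr0 addr0; apply: le_trans IH; rewrite (min_idPl h) ge_min lexx.
have := @step_expectation_le 0 e (fun=> e) N Y (lexx 0) (ltW e0) (fun=> ltW e0) mY Y0.
move=> h; apply: (le_trans (h _)).
  by move=> w; have := step w N; rewrite (min_idPl (YN w)).
rewrite lee_fin add0r -mulr_sumr; apply: (le_trans (ler_wpM2l (ltW e0) (geometric N e0))).
by rewrite mulrCA mulfV ?gt_eqF// mulr1 /e; lra.
Qed.

(** With layers of width 1, the growth [expR (x / 2)] against the tail [expR (- x)] leaves
    [expR (1 / 2)] times a geometric series of ratio [expR (- (1 / 2))], whose sum is at most 3. *)
Lemma expectation_expR_exponential_tail :
  (\int[P]_w (expR (Y w / 2))%:E <= (1 + 3 * expR (1 / 2))%:E)%E.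
Proof.
have [N YN] := steps ltr01.
pose a (k : nat) : R := expR ((k%:R + 1) / 2).
have step w m : Num.min (expR (Y w / 2)) (expR (m%:R / 2)) <=
    1 + \sum_(k < m) a k * (k%:R * 1 < Y w)%R%:R.
  elim: m => [|m IH]; first by rewrite big_ord0 mul0r expR0 ge_min addr0 lexx orbT.
  rewrite big_ord_recr/= mulr1; have [h|h] := ltP m%:R (Y w).
    apply: (@le_trans _ _ (a m)); first by rewrite /a natr1 ge_min lexx orbT.
    rewrite mulr1 addrA lerDr addr_ge0// sumr_ge0// => k _.
    by rewrite mulr_ge0// expR_ge0.
  rewrite mulr0 addr0; apply: le_trans IH.
  have h' : expR (Y w / 2) <= expR (m%:R / 2) by rewrite ler_expR ler_wpM2r ?invr_ge0.
  by rewrite (min_idPl h') ge_min lexx.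
have mF : measurable_fun setT (fun w => expR (Y w / 2)).
  by apply: measurableT_comp => //; apply: measurable_funM.
have := @step_expectation_le 1 1 a N (fun w => expR (Y w / 2)) ler01 ler01
  (fun k => expR_ge0 _) mF (fun w => expR_ge0 _).
move=> h; apply: (le_trans (h _)).
  move=> w; have := step w N.
  have h' : expR (Y w / 2) <= expR (N%:R / 2).
    by rewrite ler_expR ler_wpM2r ?invr_ge0//; have := YN w; rewrite mulr1.
  by rewrite (min_idPl h').
rewrite lee_fin lerD2l.
have aE (k : nat) : a k * expR (- (k%:R * 1)) = expR (1 / 2) * expR (- (k%:R * (1 / 2))).
  by rewrite /a -!expRD; congr expR; field.
under eq_bigr do rewrite aE.
rewrite -mulr_sumr mulrC ler_wpM2r ?expR_ge0//.
have h2 : 0 < 1 / 2 :> R by rewrite divr_gt0.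
by apply: (le_trans (geometric N h2)); lra.
Qed.

End exponential_tail.

Section risk.
Context (R : realType) (n : nat) (d : 'I_n -> measure_display).
Context (T : forall i, measurableType (d i)).
Variable mu : forall i, {measure set (T i) -> \bar R}.
Context (dO : measure_display) (Omega : measurableType dO).
Context (P : probability Omega R) (X : forall i, {mfun Omega >-> T i}).
Variables (s : densities mu) (S : set (densities mu)).
Variable shat : (forall i, T i) -> densities mu.
Hypotheses (n_gt0 : (0 < n)%N) (Xs : has_densities P X s).
Hypothesis Xind : independent_coordinates P X.
Hypotheses (cS : countable S) (hshat : rho_estimator S shat).

Let q : R := (Num.sqrt 2)^-1.

Let L w : R := loss X s shat w.

Let mL : measurable_fun setT L.
Proof. by apply: measurable_loss; case: hshat. Qed.

Let mLgt (x : R) : measurable [set w | (x < L w)%R].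
Proof.
have := @mL measurableT `]x, +oo[%classic (measurable_itv _); rewrite setTI.
by congr measurable; apply/seteqP; split => w /=; rewrite in_itv/= andbT.
Qed.

Lemma c2_gt0 : 0 < c2 :> R.
Proof. by rewrite /c2 addr_gt0// invr_gt0 sqrtr_gt0. Qed.

Lemma c3_gt0 : 0 < c3 :> R.
Proof. by rewrite /c3 mulr_gt0 ?c2_gt0// mulr_gt0// /kappa. Qed.

Lemma c1_ge1 : 1 <= c1 :> R.
Proof. by rewrite /c1; have := sqrtr_ge0 (2 : R); lra. Qed.

(** The exceptional event does not involve the estimator. Outside it the bound holds on the whole
    closure of the near minimizers, hence for any choice made there. *)
Lemma oracle_tail sbar (D xi : R) : S sbar -> Ddim P X S s sbar = D%:E -> 0 <= xi ->
  (P [set w | (oracle_bound s S sbar D xi < L w)%R] <= (expR (- xi))%:E)%E.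
Proof.
move=> Ssbar DE xi0; have [mB PB] := uniform_control n_gt0 Xs Xind Ssbar DE xi0 cS.
apply: le_trans PB; apply: le_measure; rewrite ?inE// => w /= wL.
apply: contrapT => hw; move: wL; apply/negP; rewrite -leNgt.
apply: (closure_le Xs Ssbar); last by case: hshat => _; apply.
by move=> t St wt; apply: hw; exists t.
Qed.

Lemma risk_bound_ge0 : (0 <= risk_bound P X S s)%E.
Proof.
apply: le_ereal_inf_tmp => _ [sbar Ssbar <-].
rewrite (dist2E _ Ssbar) -EFinB adde_ge0//.
  rewrite lee_fin subr_ge0; apply: (le_trans (dist2_le _ Ssbar Ssbar)).
  by rewrite ler_peMl ?hellinger2_ge0// c1_ge1.
rewrite mule_ge0 ?lee_fin ?(ltW c2_gt0)//.
exact: le_trans lee01 (Ddim_ge1 _ _ _ _ _).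
Qed.

Lemma risk_bound_approx (r e : R) : risk_bound P X S s = r%:E -> 0 < e ->
  exists sbar D, [/\ S sbar, Ddim P X S s sbar = D%:E &
    c1 * hellinger2 s sbar - dist2 s S + c2 * D <= r + e].
Proof.
move=> rE e0; have : (risk_bound P X S s < (r + e)%:E)%E by rewrite rE lte_fin ltrDl.
move=> /ereal_inf_lt[_ [sbar Ssbar <-]].
rewrite (dist2E _ Ssbar) -EFinB.
have := Ddim_ge1 P X s S sbar; case DE : (Ddim P X S s sbar) => [D| |//] _ h.
  exists sbar, D; split => //; apply: ltW; move: h.
  by rewrite -EFinM -EFinD lte_fin.
by move: h; rewrite gt0_muley ?lte_fin ?c2_gt0// addey.
Qed.

Lemma risk_tail (r xi : R) : risk_bound P X S s = r%:E -> 0 <= xi ->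
  (P [set w | (r + c3 * (29 / 20 + xi) < L w)%R] <= (expR (- xi))%:E)%E.
Proof.
move=> rE xi0; have e0 : 0 < c3 / 20 :> R by rewrite divr_gt0// c3_gt0.
have [sbar [D [Ssbar DE h]]] := risk_bound_approx rE e0.
apply: le_trans (oracle_tail Ssbar DE xi0); apply: le_measure; rewrite ?inE//.
move=> w /=; apply: le_lt_trans; rewrite /oracle_bound.
move: h c3_gt0; set a := c1 * _ - _ + _; move: (c3 : R) => c; lra.
Qed.

Lemma prob_risk (xi : R) : 0 < xi ->
  ((1 - expR (- xi))%:E <=
   P [set w | (L w)%:E <= risk_bound P X S s + (c3 * (145%:R / 100%:R + xi))%:E])%E.
Proof.
move=> xi0; have := risk_bound_ge0; case rE : (risk_bound P X S s) => [r| |//] _.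
  have -> : [set w | (L w)%:E <= r%:E + (c3 * (145%:R / 100%:R + xi))%:E]%E =
      ~` [set w | (r + c3 * (29 / 20 + xi) < L w)%R].
    apply/seteqP; split => w /=; rewrite -EFinD lee_fin;
    have -> : 145%:R / 100%:R = 29 / 20 :> R by lra.
      by move=> h; apply/negP; rewrite -leNgt.
    by move/negP; rewrite -leNgt.
  rewrite probability_setC// EFinB leeB//.
  exact: (risk_tail rE (ltW xi0)).
rewrite [X in P X](_ : _ = setT).
  by rewrite [leRHS](_ : _ = 1%E) ?probability_setT// lee_fin gerBl expR_ge0.
by apply/seteqP; split => // w _ /=; rewrite addye// leey.
Qed.

(** Scaled so that a deviation bound with slope [c3] in [xi] becomes the tail [expR (- x)]. *)
Let excess (B : R) w : R := Num.max 0 ((L w - B) / c3).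

Let excess_props (B : R) :
  (forall xi : R, 0 < xi -> (P [set w | (B + c3 * xi < L w)%R] <= (expR (- xi))%:E)%E) ->
  [/\ measurable_fun setT (excess B), forall w, 0 <= excess B w,
      forall w, excess B w <= (n%:R + `|B|) / c3,
      forall w, L w <= B + c3 * excess B w &
      forall x : R, 0 < x -> (P [set w | (x < excess B w)%R] <= (expR (- x))%:E)%E].
Proof.
move=> tail; have c30 := c3_gt0; split.
- apply: measurable_maxr => //; apply: measurable_funM => //.
  exact: measurable_funB.
- by move=> w; rewrite le_max lexx.
- move=> w; rewrite ge_max; apply/andP; split.
    by rewrite divr_ge0 ?addr_ge0// ltW.
  rewrite ler_pM2r ?invr_gt0// lerD//; first exact: loss_le.
  by rewrite -normrN ler_norm.
- move=> w; rewrite -lerBlDl mulrC -ler_pdivrMr//.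
  by rewrite le_max lexx orbT.
move=> x x0; rewrite [X in P X](_ : _ = [set w | (B + c3 * x < L w)%R]); first exact: tail.
apply/seteqP; split => w /=; rewrite lt_max ltNge (ltW x0)/= ltr_pdivlMr// ltrBrDl;
by rewrite (mulrC x).
Qed.

Lemma expected_loss_le : ('E_P[L] <= risk_bound P X S s + c4%:E)%E.
Proof.
have := risk_bound_ge0; case rE : (risk_bound P X S s) => [r| |//] _; last first.
  by rewrite addye// leey.
pose B := r + c3 * (29 / 20).
have [|mY Y0 YM LY Yt] := @excess_props B.
  move=> xi xi0; have := risk_tail rE (ltW xi0).
  by rewrite /B mulrDr addrA.
have EY := expectation_exponential_tail mY Y0 YM Yt.
have c30 := c3_gt0.
rewrite unlock.
apply: (@le_trans _ _ (\int[P]_w (B%:E + c3%:E * (excess B w)%:E))%E).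
  apply: ge0_le_integral_sup => w; first by rewrite lee_fin; exact: loss_ge0.
  by rewrite -EFinM -EFinD lee_fin.
have r0 : 0 <= r by rewrite -lee_fin -rE risk_bound_ge0.
have B0 : 0 <= B by rewrite addr_ge0// mulr_ge0 ?(ltW c30).
have mYE : measurable_fun setT (EFin \o excess B) by exact/measurable_EFinP.
rewrite ge0_integralD//; last 2 first.
- by move=> w _; rewrite mule_ge0 ?lee_fin ?(ltW c30).
- by apply: emeasurable_funM => //; exact/measurable_EFinP.
rewrite ge0_integralZl// ?lee_fin ?(ltW c30)//; last by move=> w _; rewrite lee_fin.
have -> : (\int[P]_w B%:E = B%:E)%E.
  rewrite integral_cst// [X in (_ * X)%E](_ : _ = 1%E) ?mule1//.
  exact: probability_setT.
have c3E0 : (0 <= (c3 : R)%:E)%E by rewrite lee_fin ltW.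
apply: (le_trans (leeD2l _ (lee_wpmul2l c3E0 EY))).
rewrite -EFinM -!EFinD lee_fin /B /c4; lra.
Qed.

(** The first factor compares the power of the deterministic bound with [H ^ (l / 2) + D ^ (l / 2)],
    where [H] is the squared distance from [s] to [sbar]. The second comes from bounding a power of
    the random excess by an exponential and taking its mean. *)
Definition moment_constant (l : R) : R :=
  (2 * (c1 + c2 + c3 * (7 / 5))) `^ (l / 2) *
  ((l * c3) `^ (l / 2) * expR ((2 * c3)^-1) * (1 + 3 * expR (1 / 2))).

Lemma moment_constant_gt0 l : 1 <= l -> 0 < moment_constant l.
Proof.
move=> l1; have l0 : 0 < l by rewrite (lt_le_trans ltr01).
have c20 := c2_gt0; have c30 := c3_gt0; have c11 := c1_ge1.
rewrite /moment_constant mulr_gt0//.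
  by rewrite powR_gt0// mulr_gt0// !addr_gt0// ?mulr_gt0// (lt_le_trans ltr01).
rewrite mulr_gt0 ?addr_gt0 ?mulr_gt0 ?expR_gt0//.
by rewrite powR_gt0// mulr_gt0.
Qed.

(** The inequality [ln x <= x] at [x = z / (2 * p)], where the scale is chosen to leave [z / 2] in
    the exponent. *)
Lemma powR_le_expR (p z : R) : 0 < p -> 0 < z -> z `^ p <= (2 * p) `^ p * expR (z / 2).
Proof.
move=> p0 z0; rewrite -{1}(@divfK _ (2 * p) _ z) ?gt_eqF ?mulr_gt0//.
have p20 : 0 <= 2 * p by rewrite mulr_ge0// ltW.
have zp0 : 0 <= z / (2 * p) by rewrite divr_ge0// ltW.
rewrite (powRM _ zp0 p20) [leLHS]mulrC.
rewrite ler_wpM2l ?powR_ge0// /powR gt_eqF ?divr_gt0 ?mulr_gt0//.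
rewrite ler_expR.
have zp : 0 < z / (2 * p) by rewrite divr_gt0 ?mulr_gt0.
have : ln (z / (2 * p)) <= z / (2 * p).
  by rewrite -ler_expR lnK ?posrE// (le_trans _ (expR_ge1Dx _))// lerDr.
move=> /(ler_wpM2l (ltW p0)) /le_trans; apply.
by rewrite le_eqVlt; apply/orP; left; apply/eqP; field; rewrite gt_eqF.
Qed.

Lemma hellinger_powR (t u : densities mu) (l : R) :
  hellinger t u `^ l = hellinger2 t u `^ (l / 2).
Proof.
rewrite /hellinger -powR12_sqrt ?hellinger2_ge0// -powRrM; congr (_ `^ _).
by rewrite mulrC.
Qed.

Lemma powRD_le (p a b : R) : 0 <= p -> 0 <= a -> 0 <= b ->
  (a + b) `^ p <= 2 `^ p * (a `^ p + b `^ p).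
Proof.
move=> p0 a0 b0; wlog ab : a b a0 b0 / a <= b => [hw|].
  have [|/ltW] := leP a b; first exact: hw.
  by move=> /hw; rewrite addrC (addrC (b `^ p)); apply.
apply: (@le_trans _ _ ((2 * b) `^ p)).
  by apply: ge0_ler_powR; rewrite ?nnegrE ?addr_ge0 ?mulr_ge0//; lra.
by rewrite powRM// ler_wpM2l ?powR_ge0// lerDr powR_ge0.
Qed.

Lemma expected_power_le l sbar (D : R) : 1 <= l -> S sbar -> Ddim P X S s sbar = D%:E ->
  ('E_P[fun w => (hellinger s (shat (sample X w)) `^ l)%R] <=
   (moment_constant l * (hellinger s sbar `^ l + D `^ (l / 2)))%:E)%E.
Proof.
move=> l1 Ssbar DE; have l0 : 0 < l by rewrite (lt_le_trans ltr01).
have c20 := c2_gt0; have c30 := c3_gt0; have c11 := c1_ge1.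
pose p := l / 2; have p0 : 0 < p by rewrite divr_gt0.
have D1 : 1 <= D by rewrite -lee_fin -DE Ddim_ge1.
pose H := hellinger2 s sbar; have H0 : 0 <= H by exact: hellinger2_ge0.
(* As [D >= 1], the constant [c3 * (7 / 5)] can be absorbed into the multiple of [D]; the negative
   term [- dist2] is dropped. *)
pose B : R := c1 * H + (c2 + c3 * (7 / 5)) * D.
have c3p : 0 <= c3 * (7 / 5) :> R by rewrite mulr_ge0// ltW.
have c21 : 1 <= c2 :> R by rewrite /c2 lerDl invr_ge0 sqrtr_ge0.
have B1 : 1 <= B.
  have h1 : 0 <= c1 * H by rewrite mulr_ge0// (le_trans ler01).
  have h2 : 0 <= c3 * (7 / 5) * D by rewrite mulr_ge0 ?(le_trans ler01 D1)// mulr_ge0 ?(ltW c30).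
  have h3 : 1 * 1 <= c2 * D by apply: ler_pM.
  rewrite /B mulrDl; lra.
have [|mY Y0 YM LY Yt] := @excess_props B.
  move=> xi xi0; apply: le_trans (oracle_tail Ssbar DE (ltW xi0)).
  apply: le_measure; rewrite ?inE// => w /=; apply: le_lt_trans.
  rewrite /oracle_bound /B -/H.
  have h1 : 0 <= dist2 s S by rewrite sqr_ge0.
  have h2 : c3 * (7 / 5) <= c3 * (7 / 5) * D :> R by exact: ler_peMr.
  move: h1 h2; move: (dist2 s S) (c1 * H) (c2 : R) (c3 : R) => a b c e h1 h2; lra.
have EY := expectation_expR_exponential_tail mY YM Yt.
pose A : R := (l * c3) `^ p * expR ((2 * c3)^-1).
have A0 : 0 <= A by rewrite mulr_ge0 ?powR_ge0 ?expR_ge0.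
pose Y := excess B.
have pw w : hellinger s (shat (sample X w)) `^ l <= B `^ p * A * expR (Y w / 2).
  rewrite hellinger_powR -/(L w) -/p.
  have B0 : 0 <= B by rewrite (le_trans ler01).
  have z0 : 0 < c3^-1 + Y w by rewrite ltr_wpDr// invr_gt0.
  have cz0 : 0 <= c3 * (c3^-1 + Y w) by rewrite mulr_ge0// ltW.
  (* Since [B >= 1], the additive excess becomes a factor: [B + c3 * Y <= B * (1 + c3 * Y)]. The
     power of the second factor then has a mean bounded in terms of [l] only. *)
  have hz : L w <= B * (c3 * (c3^-1 + Y w)).
    apply: (le_trans (LY w)); rewrite mulrDr mulfV ?gt_eqF// mulrDr mulr1 lerD2l.
    by apply: ler_peMl => //; apply: mulr_ge0; [exact: ltW|exact: Y0].
  apply: (@le_trans _ _ ((B * (c3 * (c3^-1 + Y w))) `^ p)).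
    apply: ge0_ler_powR; rewrite ?nnegrE ?(ltW p0) ?loss_ge0//.
    by rewrite mulr_ge0.
  rewrite (powRM _ B0 cz0) -mulrA ler_wpM2l ?powR_ge0//.
  rewrite (powRM _ (ltW c30) (ltW z0)).
  apply: (le_trans (ler_wpM2l (powR_ge0 _ _) (powR_le_expR p0 z0))).
  have p20 : 0 <= 2 * p by rewrite mulr_ge0// ltW.
  rewrite mulrA -(powRM _ (ltW c30) p20).
  rewrite (_ : c3 * (2 * p) = l * c3); last by rewrite /p; field.
  rewrite /A -mulrA -expRD.
  rewrite (_ : (c3^-1 + Y w) / 2 = (2 * c3)^-1 + Y w / 2)//.
  by field; rewrite gt_eqF.
have BA0 : 0 <= B `^ p * A by rewrite mulr_ge0// powR_ge0.
have mE : measurable_fun setT (fun w => (expR (Y w / 2))%:E).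
  apply/measurable_EFinP; apply: measurableT_comp => //.
  exact: measurable_funM.
rewrite unlock.
apply: (@le_trans _ _ (\int[P]_w ((B `^ p * A)%:E * (expR (Y w / 2))%:E))%E).
  apply: ge0_le_integral_sup => w; first by rewrite lee_fin powR_ge0.
  by rewrite -EFinM lee_fin.
rewrite ge0_integralZl// ?lee_fin//.
have BAE0 : (0 <= (B `^ p * A)%:E)%E by rewrite lee_fin.
apply: (le_trans (lee_wpmul2l BAE0 EY)).
rewrite -EFinM lee_fin /moment_constant -/p -/A hellinger_powR -/p -/H.
set M : R := c1 + c2 + c3 * (7 / 5).
rewrite [leRHS]mulrAC -[leLHS]mulrA ler_wpM2r//.
  by apply: mulr_ge0 => //; rewrite addr_ge0// mulr_ge0// expR_ge0.
have M0 : 0 <= M by rewrite /M; lra.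
have D0 : 0 <= D by rewrite (le_trans ler01).
have BM : B <= M * (H + D).
  have h1 : 0 <= c1 * D by rewrite mulr_ge0//; lra.
  have h2 : 0 <= (c2 + c3 * (7 / 5)) * H by rewrite mulr_ge0//; lra.
  rewrite /B /M; lra.
apply: (@le_trans _ _ ((M * (H + D)) `^ p)).
  by apply: ge0_ler_powR; rewrite ?nnegrE ?(ltW p0)//; [lra|rewrite mulr_ge0// addr_ge0].
rewrite (powRM _ M0 (addr_ge0 H0 D0)) (powRM _ (ler0n R 2) M0) mulrAC [leLHS]mulrC.
rewrite ler_wpM2r ?powR_ge0//.
exact: powRD_le (ltW p0) H0 D0.
Qed.

End risk.

Theorem theorem3 (R : realType) :
  exists C : R -> R, (forall l : R, 1 <= l -> 0 < C l) /\
  forall (n : nat) (d : 'I_n -> measure_display)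
    (T : forall i, measurableType (d i))
    (mu : forall i, {measure set (T i) -> \bar R})
    (S : set (densities mu)) (shat : (forall i, T i) -> densities mu),
  (3 <= n)%N -> countable S -> identifiable S -> rho_estimator S shat ->
  forall (s : densities mu)
    (dO : measure_display) (Omega : measurableType dO)
    (P : probability Omega R) (X : forall i, {mfun Omega >-> T i}),
  independent_coordinates P X -> has_densities P X s ->
  [/\ forall xi : R, 0 < xi ->
        ((1 - expR (- xi))%:E <=
         P [set w | (hellinger2 s (shat (sample X w)))%:E <=
                    risk_bound P X S s + (c3 * (145%:R / 100%:R + xi))%:E])%E,
      ('E_P[fun w => hellinger2 s (shat (sample X w))] <=
         risk_bound P X S s + c4%:E)%E
    & forall l : R, 1 <= l ->
        ('E_P[fun w => (hellinger s (shat (sample X w)) `^ l)%R] <=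
         (C l)%:E * ereal_inf
           [set (hellinger s sbar `^ l)%:E + Ddim P X S s sbar `^ (l / 2%:R)
           | sbar in S])%E].
Proof.
exists (@moment_constant R); split; first exact: moment_constant_gt0.
move=> n d T mu S shat n3 cS _ hshat s dO Omega P X Xind Xs.
have n0 : (0 < n)%N by exact: leq_trans n3.
split.
- by move=> xi xi0; exact: (prob_risk n0 Xs Xind cS hshat xi0).
- exact: (expected_loss_le n0 Xs Xind cS hshat).
move=> l l1; have C0 := moment_constant_gt0 l1.
(* After division by the positive constant each [sbar] can be treated separately; an infinite
   dimension makes the right-hand side infinite. *)
rewrite -lee_pdivrMl//; apply: le_ereal_inf_tmp => _ [sbar Ssbar <-].
rewrite lee_pdivrMl//.
have := Ddim_ge1 P X s S sbar; case DE : (Ddim P X S s sbar) => [D| |//] _.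
  rewrite poweR_EFin -EFinD -EFinM.
  exact: (expected_power_le n0 Xs Xind cS hshat l1 Ssbar DE).
have l20 : l / 2 != 0 by rewrite gt_eqF// divr_gt0// (lt_le_trans ltr01).
rewrite poweRyr//.
by rewrite addey// gt0_muley ?lte_fin// leey.
Qed.
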